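(* Let $n\ge2$ and let $f$, $D$, $\Gamma=\partial D$, $Q_f$ be as in the context. Let $(\overline\beta,\overline q)$ be a point of $Q_f$ in the inhomogeneous coordinates $(\beta,q)\in\mathbb R^{n-1}\times\mathbb R$, and suppose that near this point $Q_f$ is given by the equation $q=h(\beta)$, $\beta\in U_{\overline\beta}$, where $U_{\overline\beta}$ is a neighborhood of $\overline\beta$, $\overline q=h(\overline\beta)$, and $\det\big(h_{ij}(\beta)\big)\neq0$ in $U_{\overline\beta}$, where $h_{ij}=\partial^2h/\partial\beta_i\partial\beta_j$. Let $\overline x'=\nabla h(\overline\beta)$. If $h\in C^l(U_{\overline\beta})$ with $l\ge2$, then $Lh=g(x')$, where $L$ is the Legendre transform and $x_n=g(x')$ is the local equation of $\Gamma$ for $x'$ in a neighborhood $U_{\overline x'}$ of $\overline x'$, and $g\in C^l(U_{\overline x'})$.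
   Context: Setting: $f$ is a compactly supported function on $\mathbb R^n$, $n\ge2$, $D$ is its support, and $\Gamma=\partial D$ is a union of finitely many $C^\infty$ hypersurfaces $\Gamma_1,\dots,\Gamma_s$ in general position, each of which can be written in local coordinates as $x_n=g(x')$, $x'=(x_1,\dots,x_{n-1})$, with $g\in C^\infty$ (the paper remarks that finite smoothness of $f$ and $\Gamma$ is also allowed). Moreover $f\in C^\infty(D)$ and $f|_\Gamma\ge c>0$ (so $\Gamma$ is the discontinuity surface of $f$), and the rank of the Hessian $g_{ij}=\partial^2 g/\partial x_i\partial x_j$ is constant on each $\Gamma_j$. For $\alpha\in\mathbb R^n\setminus\{0\}$, $p\in\mathbb R$, let $l_{\alpha p}=\{x\in\mathbb R^n:\alpha\cdot x-p=0\}$. One says that $l_{\alpha p}$ is tangent to $\Gamma$ at a point $x$ of an intersection $B_m=\bigcap_{j=1}^m\Gamma_j$, $m\ge1$ (the numbering of the $\Gamma_j$ being arbitrary) if $l_{\alpha p}$ is not transversal to $B_m$ at $x$. $Q_f\subset\mathbb{RP}_n$ is the set of points $(\alpha:p)$ such that $l_{\alpha p}$ is tangent to $\Gamma$. Inhomogeneous coordinates: where $\alpha_n\ne0$, put $\beta_i=-\alpha_i/\alpha_n$ ($1\le i\le n-1$) and $q=-p/\alpha_n$, so that $l_{\alpha p}$ is the plane $x_n=\beta\cdot x'-q$. Legendre transform: for a function $h$ of $n-1$ variables with $\det h_{ij}\ne0$ in a neighborhood of $\overline\beta$, $Lh$ is the function defined in a neighborhood of $\overline x'=\nabla h(\overline\beta)$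 by $$(Lh)(x')=\beta\cdot x'-h(\beta),$$ where $\beta=\beta(x')$ is the unique solution of $x'=\nabla h(\beta)$ in a neighborhood of $\overline\beta$. *)

(* Defs.v *)
From mathcomp Require Import all_boot all_order all_algebra.
From mathcomp Require Import all_classical all_reals all_analysis.

Set Implicit Arguments.
Unset Strict Implicit.
Unset Printing Implicit Defensive.

Import Order.TTheory GRing.Theory Num.Theory.
Import numFieldNormedType.Exports.

Local Open Scope classical_set_scope.
Local Open Scope ring_scope.

Definition dot (R : realType) (d : nat) (u v : 'rV[R]_d) : R :=
  \sum_(i < d) u 0 i * v 0 i.

Definition partial (R : realType) (d : nat) (i : 'I_d) (f : 'rV[R]_d -> R) :
    'rV[R]_d -> R :=
  fun x => 'D_(delta_mx 0 i) f x.

Definition grad (R : realType) (d : nat) (f : 'rV[R]_d -> R) (x : 'rV[R]_d) :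
    'rV[R]_d :=
  \row_i partial i f x.

Definition hessian (R : realType) (d : nat) (f : 'rV[R]_d -> R)
    (x : 'rV[R]_d) : 'M[R]_d :=
  \matrix_(i, j) partial j (partial i f) x.

(* Only meant for open U: functions are total, and the values of f outside U
   are irrelevant. *)
Fixpoint class_C (R : realType) (d : nat) (k : nat) (U : set 'rV[R]_d)
    (f : 'rV[R]_d -> R) : Prop :=
  (forall x, U x -> {for x, continuous f}) /\
  if k is k'.+1 then
    forall i : 'I_d,
      (forall x, U x -> derivable f x (delta_mx 0 i)) /\
      class_C k' U (partial i f)
  else True.

Definition smooth_near (R : realType) (d : nat) (a : 'rV[R]_d)
    (f : 'rV[R]_d -> R) : Prop :=
  exists2 U, open_nbhs a U & forall k, class_C k U f.

(* The ambient space is R^n with n = d.+1.  For k : 'I_d.+1, col' k x is x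
   with its k-th coordinate deleted; x' is col' ord_max x and x_n is
   x 0 ord_max. *)

(* Near x, the set S is contained in the smooth graph y_k = g (col' k y).  If
   S has no boundary at x, it coincides with this graph; if it has one, the
   graph extends S across its boundary. *)
Definition graph_chart (R : realType) (d : nat) (S : set 'rV[R]_d.+1)
    (x : 'rV[R]_d.+1) (k : 'I_d.+1) (g : 'rV[R]_d -> R) : Prop :=
  [/\ smooth_near (col' k x) g,
      x 0 k = g (col' k x) &
      \forall y \near x, S y -> y 0 k = g (col' k y)].

Definition interior_point (R : realType) (d : nat) (S : set 'rV[R]_d.+1)
    (x : 'rV[R]_d.+1) : Prop :=
  S x /\ exists k g,
    smooth_near (col' k x) g /\
    \forall y \near x, S y <-> y 0 k = g (col' k y).

(* A closed smooth hypersurface, possibly with a boundary, at which edges and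
   corners are allowed (as for the faces of a polytope). *)
Definition hypersurface (R : realType) (d : nat) (S : set 'rV[R]_d.+1) :
    Prop :=
  [/\ closed S,
      forall x, S x -> exists k g, graph_chart S x k g &
      S `<=` closure (interior_point S)].

(* For x in a hypersurface S the result does not depend on the chart: S is
   the closure of its interior points, so any two charts agree to first (in
   fact to every) order at x. *)
Definition tangent_vector (R : realType) (d : nat) (S : set 'rV[R]_d.+1)
    (x v : 'rV[R]_d.+1) : Prop :=
  exists k g,
    graph_chart S x k g /\ v 0 k = dot (grad g (col' k x)) (col' k v).

Definition normal_vector (R : realType) (d : nat) (S : set 'rV[R]_d.+1)
    (x nu : 'rV[R]_d.+1) : Prop :=
  nu != 0 /\ forall v, tangent_vector S x v -> dot nu v = 0.

Definition common_points (R : realType) (d s : nat)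
    (Gam : 'I_s -> set 'rV[R]_d.+1) (I : {set 'I_s}) : set 'rV[R]_d.+1 :=
  [set x | forall i, i \in I -> Gam i x].

(* The tangent space of common_points Gam I at x, by general position. *)
Definition common_tangent (R : realType) (d s : nat)
    (Gam : 'I_s -> set 'rV[R]_d.+1) (I : {set 'I_s}) (x : 'rV[R]_d.+1) :
    set 'rV[R]_d.+1 :=
  [set v | forall i, i \in I -> tangent_vector (Gam i) x v].

Definition general_position (R : realType) (d s : nat)
    (Gam : 'I_s -> set 'rV[R]_d.+1) : Prop :=
  forall (I : {set 'I_s}) (x : 'rV[R]_d.+1), common_points Gam I x ->
  forall nu : 'I_s -> 'rV[R]_d.+1,
    (forall i, i \in I -> normal_vector (Gam i) x (nu i)) ->
  forall a : 'I_s -> R, \sum_(i in I) a i *: nu i = 0 ->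
  forall i, i \in I -> a i = 0.

Definition supp (R : realType) (d : nat) (f : 'rV[R]_d -> R) : set 'rV[R]_d :=
  closure [set x | f x != 0].

Definition boundary (T : topologicalType) (A : set T) : set T :=
  closure A `\` interior A.

Record jump_setting (R : realType) (d s : nat) (f : 'rV[R]_d.+1 -> R)
    (Gam : 'I_s -> set 'rV[R]_d.+1) : Prop := {
  jump_compact : compact (supp f);
  jump_boundary : boundary (supp f) = \bigcup_i Gam i;
  jump_hypersurface : forall j, hypersurface (Gam j);
  (* The union has no free edges: the pieces end on one another.  Void for
     hypersurfaces without boundary. *)
  jump_edges : forall j x, Gam j x -> ~ interior_point (Gam j) x ->
    exists2 i, i != j & Gam i x;
  jump_position : general_position Gam;
  (* f is smooth up to the boundary of its support *)
  jump_smooth : exists F : 'rV[R]_d.+1 -> R,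
    (forall k, class_C k setT F) /\ (forall x, supp f x -> f x = F x);
  jump_positive : exists2 c : R, 0 < c &
    forall x, boundary (supp f) x -> c <= f x;
  jump_rank : forall j, exists r : nat, forall x, Gam j x ->
    forall k g, graph_chart (Gam j) x k g ->
    \rank (hessian g (col' k x)) = r
}.

Definition hyperplane (R : realType) (d : nat) (al : 'rV[R]_d) (p : R) :
    set 'rV[R]_d :=
  [set x | dot al x - p = 0].

(* The direction of the hyperplane and the tangent space of the intersection
   of the Gam i, i in I, together span the whole space. *)
Definition transversal_at (R : realType) (d s : nat)
    (Gam : 'I_s -> set 'rV[R]_d.+1) (al : 'rV[R]_d.+1) (I : {set 'I_s})
    (x : 'rV[R]_d.+1) : Prop :=
  forall w, exists u v, [/\ dot al u = 0, common_tangent Gam I x v & w = u + v].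

Definition tangent_plane (R : realType) (d s : nat)
    (Gam : 'I_s -> set 'rV[R]_d.+1) (al : 'rV[R]_d.+1) (p : R) : Prop :=
  exists (I : {set 'I_s}) (x : 'rV[R]_d.+1),
    [/\ I != finset.set0, common_points Gam I x, hyperplane al p x &
        ~ transversal_at Gam al I x].

(* Q_f as the set of all homogeneous coordinates of its points. *)
Definition Qset (R : realType) (d s : nat) (Gam : 'I_s -> set 'rV[R]_d.+1) :
    set ('rV[R]_d.+1 * R) :=
  [set ap | ap.1 != 0 /\ tangent_plane Gam ap.1 ap.2].

Definition Qset_affine (R : realType) (d s : nat)
    (Gam : 'I_s -> set 'rV[R]_d.+1) : set ('rV[R]_d * R) :=
  [set bq | exists al p,
    [/\ Qset Gam (al, p), al 0 ord_max != 0,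
        bq.1 = - (al 0 ord_max)^-1 *: col' ord_max al &
        bq.2 = - p / al 0 ord_max]].

(* g is the Legendre transform of h, taken at bbar, on the neighbourhood V of
   grad h bbar. *)
Definition is_legendre (R : realType) (d : nat) (U : set 'rV[R]_d)
    (h : 'rV[R]_d -> R) (bbar : 'rV[R]_d) (V : set 'rV[R]_d)
    (g : 'rV[R]_d -> R) : Prop :=
  exists N : set 'rV[R]_d, [/\ nbhs bbar N, N `<=` U &
    forall x', V x' -> exists b,
      [/\ N b, x' = grad h b,
          forall b', N b' -> x' = grad h b' -> b' = b &
          g x' = dot b x' - h b]].

(* For x' in V, the part of G at height close to g xbar has the equation
   x_n = g x'. *)
Definition local_equation (R : realType) (d : nat) (G : set 'rV[R]_d.+1)
    (V : set 'rV[R]_d) (g : 'rV[R]_d -> R) : Prop :=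
  exists J : set R, [/\ open J, forall x', V x' -> J (g x') &
    forall x : 'rV[R]_d.+1, V (col' ord_max x) -> J (x 0 ord_max) ->
      (G x <-> x 0 ord_max = g (col' ord_max x))].

(* Main.v *)
Require Import Defs.
From mathcomp Require Import all_boot all_order all_algebra.
From mathcomp Require Import all_classical all_reals all_analysis.
From HB Require Import structures.
From mathcomp Require Import ring lra.

Set Implicit Arguments.
Unset Strict Implicit.
Unset Printing Implicit Defensive.

Import Order.TTheory GRing.Theory Num.Theory.
Import numFieldNormedType.Exports.

Local Open Scope classical_set_scope.
Local Open Scope ring_scope.

(** A hyperplane x_n = b.x' - q through a point x of the singular hypersurface
    touches it there when the covector (-b, 1) is a combination of the normals
    of the pieces that contain x.  Such a pair (x, b) is called a contact, and
    Q_f is the set of the (b, q) that come from contacts (Qset_affineP).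

    The main point is contact_point: a contact whose slope b is close to bbar
    and whose level is h b satisfies x' = grad h b.  Consider the contacts
    (x, b) in which x runs through the stratum common to given pieces.  They
    form a manifold, parametrized by x and by the coefficients of the covector
    in the normals.  Along it q = b.x' - x_n, hence dq = x'.db, as x moves
    inside the hyperplane; on the other hand q = h b.  So (x' - grad h b).db = 0
    on this manifold.  Since second derivatives are symmetric, this relation
    makes the direction that moves x radially away from the point of the
    hyperplane over grad h b, with b fixed, tangent to the manifold
    (radial_curve).  If the gap x' - grad h b were not zero, contacts could be
    pushed ever farther away along their hyperplanes; as the singular
    hypersurface is compact, this is impossible.  The proof of contact_point
    expresses it by a maximum: a cutoff in b times the squared gap cannot have a
    positive one.

    The argument needs the strata to be manifolds without boundary although the
    pieces have edges.  The edges of a piece lie on other pieces, which meet it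
    in general position; so near a point x0 each piece that contains x0 contains
    the whole common zero set of the defining functions of the pieces through
    x0 (local_frame_exists).

    Consequently each slope b near bbar has exactly one point of contact at the
    level h b, namely (grad h b, b.grad h b - h b).  As the Hessian of h is invertible,
    grad h is a local homeomorphism (gradient_local_inverse), and these points
    fill the graph of the Legendre transform g of h, which therefore lies in
    the singular hypersurface.  At the point over grad h bbar every normal is
    proportional to (-bbar, 1), since otherwise the slope could move while the
    point of contact stays fixed to first order (contact_normals).  General
    position leaves a single piece there, whose defining function is strictly
    monotone in x_n: the graph of g is all of the singular hypersurface nearby,
    and g is as smooth as this function (implicit_class_C). *)

(** * Norms and scalar products of row vectors *)

Lemma near_normP (R : realType) (V : normedModType R) (a : V) (P : set V) :
  (\forall x \near a, P x) <->
  exists2 r : R, 0 < r & forall x, `|x - a| < r -> P x.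
Proof.
split=> [/nbhs_ballP[r /= r0 rP]|[r r0 rP]].
  by exists r => // x xa; apply: rP; rewrite -ball_normE /= distrC.
apply/nbhs_ballP; exists r => // x; rewrite -ball_normE /= distrC.
exact: rP.
Qed.

Lemma continuous_normP (R : realType) (V W : normedModType R) (f : V -> W) a :
  {for a, continuous f} <-> forall e : R, 0 < e ->
    \forall x \near a, `|f x - f a| < e.
Proof.
split=> [/cvgrPdist_lt fa e /fa|fa]; first by apply: filterS => x; rewrite distrC.
by apply/cvgrPdist_lt => e /fa; apply: filterS => x; rewrite distrC.
Qed.

Lemma near_setX (T T' : topologicalType) (x : T) (y : T') (P : set T)
    (Q : set T') :
  (\forall a \near x, P a) -> (\forall b \near y, Q b) ->
  \forall ab \near (x, y), P ab.1 /\ Q ab.2.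
Proof. by move=> xP yQ; exists (P, Q). Qed.

Section dot_product.
Context {R : realType} {n : nat}.
Implicit Types u v w : 'rV[R]_n.

Lemma dotC u v : dot u v = dot v u.
Proof. by apply: eq_bigr => i _; rewrite mulrC. Qed.

Lemma dotDr u v w : dot u (v + w) = dot u v + dot u w.
Proof. by rewrite -big_split; apply: eq_bigr => i _; rewrite mxE mulrDr. Qed.

Lemma dotZr c u v : dot u (c *: v) = c * dot u v.
Proof. by rewrite mulr_sumr; apply: eq_bigr => i _; rewrite mxE mulrCA. Qed.

Lemma dotNr u v : dot u (- v) = - dot u v.
Proof. by rewrite -scaleN1r dotZr mulN1r. Qed.

Lemma dotBr u v w : dot u (v - w) = dot u v - dot u w.
Proof. by rewrite dotDr dotNr. Qed.

Lemma dotDl u v w : dot (u + v) w = dot u w + dot v w.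
Proof. by rewrite dotC dotDr !(dotC w). Qed.

Lemma dotZl c u v : dot (c *: u) v = c * dot u v.
Proof. by rewrite dotC dotZr dotC. Qed.

Lemma dotNl u v : dot (- u) v = - dot u v.
Proof. by rewrite dotC dotNr dotC. Qed.

Lemma dot0r u : dot u 0 = 0.
Proof. by rewrite /dot big1 // => i _; rewrite mxE mulr0. Qed.

Lemma dot0l u : dot 0 u = 0.
Proof. by rewrite dotC dot0r. Qed.

Lemma dot_sumr (I : Type) (r : seq I) (P : pred I) (F : I -> 'rV[R]_n) u :
  dot u (\sum_(i <- r | P i) F i) = \sum_(i <- r | P i) dot u (F i).
Proof.
by elim/big_rec2: _ => [|i x y _ <-]; rewrite ?dot0r // dotDr.
Qed.

Lemma dot_suml (I : Type) (r : seq I) (P : pred I) (F : I -> 'rV[R]_n) u :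
  dot (\sum_(i <- r | P i) F i) u = \sum_(i <- r | P i) dot (F i) u.
Proof. by rewrite dotC dot_sumr; apply: eq_bigr => i _; rewrite dotC. Qed.

Lemma dot_delta u i : dot u (delta_mx 0 i) = u 0 i.
Proof.
rewrite /dot (bigD1 i) //= mxE !eqxx mulr1 big1 ?addr0 // => j ji.
by rewrite mxE (negPf ji) andbF mulr0.
Qed.

Lemma dot_ge0 u : 0 <= dot u u.
Proof. by apply: sumr_ge0 => i _; rewrite -expr2 sqr_ge0. Qed.

Lemma sqr_coord_le_dot u i : u 0 i ^+ 2 <= dot u u.
Proof.
rewrite /dot (bigD1 i) //= expr2 lerDl.
by apply: sumr_ge0 => j _; rewrite -expr2 sqr_ge0.
Qed.

Lemma dot_eq0 u : dot u u = 0 -> u = 0.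
Proof.
move=> u0; apply/rowP => i; rewrite mxE; apply/eqP; rewrite -sqrf_eq0.
by rewrite eq_le sqr_ge0 andbT -u0 sqr_coord_le_dot.
Qed.

Lemma coord_le_norm u i : `|u 0 i| <= `|u|.
Proof.
rewrite [leRHS]/Num.norm /= mx_normrE; apply/bigmax_geP; right.
by exists (0, i).
Qed.

Lemma norm_le_coord u e : 0 <= e -> (forall i, `|u 0 i| <= e) -> `|u| <= e.
Proof.
move=> e0 ue; rewrite [leLHS]/Num.norm /= mx_normrE; apply/bigmax_leP.
by split=> // -[i j] _ /=; rewrite ord1.
Qed.

Lemma norm_lt_coord u e : 0 < e -> (forall i, `|u 0 i| < e) -> `|u| < e.
Proof.
move=> e0 ue; rewrite [ltLHS]/Num.norm /= mx_normrE; apply/bigmax_ltP.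
by split=> // -[i j] _ /=; rewrite ord1.
Qed.

Lemma norm_dot_le u v : `|dot u v| <= (\sum_i `|u 0 i|) * `|v|.
Proof.
rewrite mulr_suml; apply: le_trans (ler_norm_sum _ _ _) _.
by apply: ler_sum => i _; rewrite normrM ler_wpM2l // coord_le_norm.
Qed.

Lemma norm_sqr_le_dot u : `|u| ^+ 2 <= dot u u.
Proof.
rewrite -(sqr_sqrtr (dot_ge0 u)) ler_sqr ?nnegrE ?sqrtr_ge0 //.
apply: norm_le_coord (sqrtr_ge0 _) _ => i.
by rewrite -sqrtr_sqr ler_sqrt ?dot_ge0 ?sqr_coord_le_dot.
Qed.

End dot_product.

(** * Maps of class C^k *)

Section class_C_basics.
Context {R : realType} {n : nat}.
Implicit Types (U V : set 'rV[R]_n) (f : 'rV[R]_n -> R).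

Lemma class_C_continuous k U f x : class_C k U f -> U x -> {for x, continuous f}.
Proof. by case: k => [|k] [+ _] Ux => /(_ x Ux). Qed.

Lemma class_C_partial k U f i : class_C k.+1 U f -> class_C k U (partial i f).
Proof. by case=> _ /(_ i)[]. Qed.

Lemma class_C_derivable k U f i x :
  class_C k.+1 U f -> U x -> derivable f x (delta_mx 0 i).
Proof. by case=> _ /(_ i)[+ _] Ux; apply. Qed.

Lemma class_CW k U f : class_C k.+1 U f -> class_C k U f.
Proof.
elim: k f => [|k IH] f fC; first by case: fC.
split; first by case: fC.
by move=> i; split=> [x|]; [exact: class_C_derivable fC|exact/IH/class_C_partial].
Qed.

Lemma class_C_le k l U f : (k <= l)%N -> class_C l U f -> class_C k U f.
Proof.
by move=> /subnK <-; elim: (l - k)%N => // m IH /class_CW; exact: IH.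
Qed.

End class_C_basics.

(** * Strict differentiability *)

Section strict_differentiability.
Context {R : realType} {n : nat}.
Implicit Types (U : set 'rV[R]_n) (f : 'rV[R]_n -> R) (a w : 'rV[R]_n).

(** Both points vary: this uniform version of differentiability is what the
    contraction argument of the local inversion uses. *)
Definition strict_diff f a w := forall e : R, 0 < e ->
  exists2 r : R, 0 < r & forall x y, `|x - a| < r -> `|y - a| < r ->
    `|f x - f y - dot w (x - y)| <= e * `|x - y|.

Lemma line_is_derive f (y v : 'rV[R]_n) (t : R) :
  derivable f (y + t *: v) v ->
  is_derive t 1 (fun s => f (y + s *: v)) ('D_v f (y + t *: v)).
Proof.
have E : (fun h : R => h^-1 *: (((fun s => f (y + s *: v)) \o shift t) (h *: 1)
      - f (y + t *: v))) =
    (fun h : R => h^-1 *: ((f \o shift (y + t *: v)) (h *: v)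
      - f (y + t *: v))).
  apply: funext => h /=; congr (_ *: (f _ - _)).
  by rewrite /GRing.scale /= mulr1 -/(GRing.scale _ _) scalerDl addrCA.
by move=> df; split; rewrite ?/derivable ?/derive E.
Qed.

Lemma mean_value_oriented (F dF : R -> R) (c : R) :
  (forall s : R, `|s| <= `|c| -> is_derive s 1 F (dF s)) ->
  exists2 s, `|s| <= `|c| & F c - F 0 = dF s * c.
Proof.
move=> dfF.
have Fcont (a b : R) : (forall s, s \in `[a, b] -> `|s| <= `|c|) ->
    {within `[a, b], continuous F}.
  by move=> ab; apply: derivable_within_continuous => s /ab /dfF [].
have [c0|/ltW c0] := leP 0 c.
  have ab s : s \in `[0, c] -> `|s| <= `|c|.
    by rewrite in_itv /= => /andP[s0 sc]; rewrite !ger0_norm.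
  have dI s : s \in `]0, c[ -> is_derive s 1 F (dF s).
    by move=> sc; exact/dfF/ab/subset_itv_oo_cc.
  have [s sc E] := MVT_segment c0 dI (Fcont _ _ ab).
  by exists s; [exact: ab|rewrite E subr0].
have ab s : s \in `[c, 0] -> `|s| <= `|c|.
  by rewrite in_itv /= => /andP[s0 sc]; rewrite !ler0_norm // lerN2.
have dI s : s \in `]c, 0[ -> is_derive s 1 F (dF s).
  by move=> sc; exact/dfF/ab/subset_itv_oo_cc.
have [s sc E] := MVT_segment c0 dI (Fcont _ _ ab).
by exists s; [exact: ab|rewrite -opprB E sub0r mulrN opprK].
Qed.

Lemma line_mean_value f (z v : 'rV[R]_n) (c : R) :
  (forall s, `|s| <= `|c| -> derivable f (z + s *: v) v) ->
  exists2 s, `|s| <= `|c| & f (z + c *: v) - f z = 'D_v f (z + s *: v) * c.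
Proof.
move=> df; have [s /df /line_is_derive|s sc E] :=
    @mean_value_oriented (fun s => f (z + s *: v))
      (fun s => 'D_v f (z + s *: v)) c; first by [].
by exists s => //; rewrite -E scale0r addr0.
Qed.

(** Going from y to x one coordinate at a time, the mean value theorem turns
    each difference into a partial derivative at a nearby point. *)
Lemma class_C_strict_diff U f a :
  open U -> U a -> class_C 1 U f -> strict_diff f a (grad f a).
Proof.
move=> oU Ua fC e e0.
have n0 : 0 < n.+1%:R :> R by rewrite ltr0n.
have e'0 : 0 < e / n.+1%:R by rewrite divr_gt0.
have near_part (i : 'I_n) : \forall x \near a,
    `|partial i f x - partial i f a| < e / n.+1%:R.
  by have /continuous_normP := class_C_continuous (class_C_partial i fC) Ua; exact.
have near_all : \forall x \near a, U x /\
    forall i, `|partial i f x - partial i f a| < e / n.+1%:R.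
  apply: filterI; first exact: open_nbhs_nbhs.
  by apply: filter_forall near_part.
have /near_normP[r r0 rP] := near_all.
(* The points given by the mean value theorem lie between z i and z i.+1 or
   on the other side of z i, hence the factor 3. *)
exists (r / 3); first by rewrite divr_gt0.
move=> x y xa ya.
pose z (m : nat) := \row_(i < n) (if (i < m)%N then x 0 i else y 0 i).
have zx : z n = x by apply/rowP => i; rewrite mxE ltn_ord.
have zy : z 0%N = y by apply/rowP => i; rewrite mxE.
have zS (i : 'I_n) : z i.+1 = z i + (x - y) 0 i *: delta_mx 0 i.
  apply/rowP => j; rewrite !mxE eqxx /= ltnS leq_eqVlt.
  case: (eqVneq j i) => [->|ji] /=; first by rewrite eqxx ltnn mulr1 addrC subrK.
  by rewrite -(inj_eq val_inj) in ji; rewrite (negPf ji) mulr0 addr0.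
have za (i : 'I_n) s : `|s| <= `|(x - y) 0 i| ->
    `|z i + s *: delta_mx 0 i - a| < r.
  move=> sc; have -> : r = r / 3 + 2 * (r / 3) by field.
  have sr : `|s| < 2 * (r / 3).
    apply: le_lt_trans sc _; apply: le_lt_trans (coord_le_norm _ _) _.
    have -> : x - y = (x - a) - (y - a) by rewrite opprB addrA subrK.
    by apply: le_lt_trans (ler_normB _ _) _; rewrite mulr2n mulrDl mul1r ltrD.
  apply: norm_lt_coord => [|j]; first by rewrite addr_gt0 ?mulr_gt0 ?divr_gt0.
  rewrite addrAC mxE; apply: le_lt_trans (ler_normD _ _) _.
  rewrite ltrD //; last first.
    apply: le_lt_trans sr; rewrite !mxE normrM ler_piMr //.
    by case: (_ && _); rewrite ?normr1 ?normr0.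
  rewrite !mxE; case: ifP => _.
    by apply: le_lt_trans xa; have := coord_le_norm (x - a) j; rewrite !mxE.
  by apply: le_lt_trans ya; have := coord_le_norm (y - a) j; rewrite !mxE.
have step (i : 'I_n) :
    `|f (z i.+1) - f (z i) - grad f a 0 i * (x - y) 0 i| <=
    e / n.+1%:R * `|x - y|.
  have [|s sc] := @line_mean_value f (z i) (delta_mx 0 i) ((x - y) 0 i).
    by move=> s /za /rP[Uz _]; exact: class_C_derivable fC Uz.
  rewrite -zS => ->; rewrite [grad _ _ _ _]mxE -mulrBl normrM.
  apply: ler_pM => //; last exact: coord_le_norm.
  by have [_ /(_ i)/ltW] := rP _ (za _ _ sc).
have -> : f x - f y = \sum_(i < n) (f (z i.+1) - f (z i)).
  have := telescope_sumr (fun m => f (z m)) (leq0n n).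
  by rewrite zx zy big_mkord.
rewrite /dot -sumrB; apply: le_trans (ler_norm_sum _ _ _) _.
apply: le_trans (ler_sum _ (fun i _ => step i)) _.
rewrite sumr_const card_ord -mulrnAl ler_wpM2r // -mulr_natl.
rewrite mulrCA ler_piMr ?(ltW e0) // ler_pdivrMr // mul1r ler_nat.
exact: leqnSn.
Qed.

Lemma strict_diff_continuous f a w : strict_diff f a w -> {for a, continuous f}.
Proof.
move=> /(_ 1 ltr01)[r r0 fr]; apply/continuous_normP => e e0.
pose K := \sum_i `|w 0 i| + 1.
have K0 : 0 < K by rewrite ltr_wpDl // sumr_ge0.
apply/near_normP; exists (Num.min r (e / K)) => [|x].
  by rewrite lt_min r0 divr_gt0.
rewrite lt_min => /andP[xr xe].
have := fr x a xr; rewrite subrr normr0 => /(_ r0); rewrite mul1r => fx.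
have -> : f x - f a = (f x - f a - dot w (x - a)) + dot w (x - a) by ring.
apply: le_lt_trans (ler_normD _ _) _.
apply: le_lt_trans (lerD fx (norm_dot_le _ _)) _.
by rewrite -[X in X + _]mul1r -mulrDl [1 + _]addrC mulrC -ltr_pdivlMr.
Qed.


End strict_differentiability.

Section curves.
Context {R : realType} {V : normedModType R}.

Lemma is_derive_approxP (f : V -> R) (a v : V) (l : R) :
  is_derive a v f l <-> forall e : R, 0 < e -> \forall s \near (0 : R),
    `|f (a + s *: v) - f a - s * l| <= e * `|s|.
Proof.
split=> [[df <-] e e0|H].
  have /eqaddoP/(_ e e0) := derivable_nbhs df.
  apply: filterS => s; rewrite -![(_ - _ : _ -> _)]/(_ - _) /=.
  rewrite -![(_ + _ : _ -> _) _]/(_ + _) -![(- _ : _ -> _) _]/(- _) /cst /=.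
  by rewrite opprD addrA [s *: v + a]addrC.
have fl : (fun h : R => h^-1 *: ((f \o shift a) (h *: v) - f a)) @ 0^' --> (l : R^o).
  apply/cvgrPdist_le => e e0; rewrite near_withinE.
  apply: filterS (H e e0) => s /= se s0.
  rewrite distrC -(@mulKf _ s s0 l) -[_ *: _]/(_ * _) -mulrBr normrM normfV.
  by rewrite ler_pdivrMl ?normr_gt0 // [leRHS]mulrC [s *: v + a]addrC.
by split; [apply/cvg_ex; exists l | apply: cvg_lim].
Qed.

Lemma strict_diff_comp n (f : 'rV[R]_n -> R) (c : V -> 'rV[R]_n) (a v : V)
    (w u : 'rV[R]_n) :
  strict_diff f (c a) w ->
  (forall i, is_derive a v (fun s => c s 0 i) (u 0 i)) ->
  is_derive a v (fun s => f (c s)) (dot w u).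
Proof.
move=> fc dc; apply/is_derive_approxP => e e0.
pose K := \sum_i `|w 0 i| + 1.
have K0 : 0 < K by rewrite ltr_wpDl // sumr_ge0.
pose L := `|u| + 1.
have L0 : 0 < L by rewrite ltr_wpDl.
pose eta := Num.min 1 (e / 2 / K).
have eta0 : 0 < eta by rewrite lt_min ltr01 !divr_gt0.
have [r r0 fr] := fc (e / 2 / L) ltac:(by rewrite !divr_gt0).
have near_c : \forall s \near (0 : R), `|s| < r / L /\
    forall i, `|c (a + s *: v) 0 i - c a 0 i - s * u 0 i| <= eta * `|s|.
  apply: filterI.
    apply/(@near_normP R R^o); exists (r / L) => [|s]; first by rewrite divr_gt0.
    by rewrite subr0.
  have dcE (i : 'I_n) := (is_derive_approxP _ _ _ _).1 (dc i) eta eta0.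
  exact: filter_forall dcE.
apply: filterS near_c => s [sr sc].
pose D := c (a + s *: v) - c a.
have DE : `|D - s *: u| <= eta * `|s|.
  apply: norm_le_coord => [|i]; first by rewrite mulr_ge0 ?(ltW eta0).
  by have := sc i; rewrite !mxE.
have DL : `|D| <= L * `|s|.
  rewrite -[D](subrK (s *: u)); apply: le_trans (ler_normD _ _) _.
  rewrite mulrDl addrC mul1r normrZ [`|s| * _]mulrC lerD2l.
  by apply: le_trans DE _; rewrite ler_piMl // ge_min lexx.
have := fr (c (a + s *: v)) (c a).
rewrite subrr normr0 r0 -/D => /(_ _ isT) H.
have {}H : `|f (c (a + s *: v)) - f (c a) - dot w D| <= e / 2 / L * `|D|.
  by apply: H; apply: le_lt_trans DL _; rewrite mulrC -ltr_pdivlMr.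
have -> : f (c (a + s *: v)) - f (c a) - s * dot w u =
    (f (c (a + s *: v)) - f (c a) - dot w D) + dot w (D - s *: u).
  by rewrite (dotBr w D) dotZr; ring.
apply: le_trans (ler_normD _ _) _.
rewrite (splitr e) mulrDl lerD //.
  apply: le_trans H _; rewrite -mulrA ler_wpM2l ?divr_ge0 ?(ltW e0) //.
  by rewrite ler_pdivrMl.
apply: le_trans (norm_dot_le _ _) _.
have SK : \sum_i `|w 0 i| <= K by rewrite lerDl ler01.
apply: le_trans (ler_pM _ _ SK DE) _; [exact: sumr_ge0|exact: normr_ge0|].
rewrite mulrA ler_wpM2r // mulrC -ler_pdivlMr //.
by rewrite ge_min lexx orbT.
Qed.

Lemma is_derive_addf (f g : V -> R) (a v : V) (df dg : R) :
  is_derive a v f df -> is_derive a v g dg ->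
  is_derive a v (fun x => f x + g x) (df + dg).
Proof. by move=> fa ga; apply: is_deriveD. Qed.

Lemma is_derive_mulf (f g : V -> R) (a v : V) (df dg : R) :
  is_derive a v f df -> is_derive a v g dg ->
  is_derive a v (fun x => f x * g x) (df * g a + f a * dg).
Proof.
move=> fa ga; have -> : df * g a + f a * dg = f a *: dg + g a *: df.
  by rewrite /GRing.scale /= addrC [df * _]mulrC.
exact: is_deriveM.
Qed.

Lemma is_derive_oppf (f : V -> R) (a v : V) (df : R) :
  is_derive a v f df -> is_derive a v (fun x => - f x) (- df).
Proof. by move=> fa; apply: is_deriveN. Qed.

Lemma is_derive_subf (f g : V -> R) (a v : V) (df dg : R) :
  is_derive a v f df -> is_derive a v g dg ->
  is_derive a v (fun x => f x - g x) (df - dg).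
Proof. by move=> fa ga; apply: is_deriveB. Qed.

Lemma is_derive_sumf (I : finType) (P : pred I) (f : I -> V -> R) (a v : V)
    (df : I -> R) :
  (forall i, P i -> is_derive a v (f i) (df i)) ->
  is_derive a v (fun x => \sum_(i | P i) f i x) (\sum_(i | P i) df i).
Proof.
move=> fa; rewrite (_ : (fun x => _) = \sum_(i | P i) f i); last first.
  by apply: funext => x; rewrite fct_sumE.
elim/big_ind2: _ => //= [|g dg k dk]; first exact: is_derive_cst.
exact: is_deriveD.
Qed.

Lemma is_derive_invf (f : V -> R) (a v : V) (df : R) :
  f a != 0 -> is_derive a v f df ->
  is_derive a v (fun x => (f x)^-1) (- (df * (f a)^-1 * (f a)^-1)).
Proof.
move=> fa0 [fa <-]; split; first exact: derivableV.
rewrite deriveV // /GRing.scale /= mulNr; congr (- _).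
by rewrite expr2 invfM mulrC mulrA.
Qed.

End curves.

(** * Symmetry of second derivatives and algebra of C^k maps *)

Section symmetric_hessian.
Context {R : realType} {n : nat}.
Implicit Types (U : set 'rV[R]_n) (f : 'rV[R]_n -> R).

(** Any mixed second difference is a value of one of the two mixed partial
    derivatives, but it does not see the order of the two directions. *)
Lemma second_difference U f a (i j : 'I_n) (r t : R) :
  class_C 2 U f -> (forall x, `|x - a| < r -> U x) -> 2 * `|t| < r ->
  exists2 x, `|x - a| <= 2 * `|t| &
    f (a + t *: delta_mx 0 j + t *: delta_mx 0 i)
      - f (a + t *: delta_mx 0 i) - (f (a + t *: delta_mx 0 j) - f a) =
    partial j (partial i f) x * t * t.
Proof.
move=> fC rU tr; set ei := delta_mx 0 i; set ej := delta_mx 0 j.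
have norm_delta (k : 'I_n) : `|delta_mx 0 k : 'rV[R]_n| <= 1.
  apply: norm_le_coord => // l; rewrite mxE.
  by case: (_ && _); rewrite ?normr1 ?normr0.
have in_ball s s' : `|s| <= `|t| -> `|s'| <= `|t| ->
    `|a + s *: ei + s' *: ej - a| <= 2 * `|t|.
  move=> st s't; rewrite -(addrA a) [_ - a]addrC addKr mulr2n mulrDl mul1r.
  apply: le_trans (ler_normD _ _) _; rewrite !normrZ.
  by apply: lerD; rewrite -[leRHS]mulr1; apply: ler_pM => //; exact: norm_delta.
have inU s s' : `|s| <= `|t| -> `|s'| <= `|t| -> U (a + s *: ei + s' *: ej).
  by move=> st s't; apply: rU; apply: le_lt_trans tr; exact: in_ball.
have t0 : `|0 : R| <= `|t| by rewrite normr0.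
have [s st|s st E] := @mean_value_oriented R
    (fun s => f (a + t *: ej + s *: ei) - f (a + s *: ei))
    (fun s => partial i f (a + t *: ej + s *: ei) - partial i f (a + s *: ei)) t.
  apply: is_derive_subf; apply: line_is_derive.
    by apply: (class_C_derivable fC); rewrite addrAC; exact: inU.
  by apply: (class_C_derivable fC); have := inU s 0 st t0; rewrite scale0r addr0.
have [s' s't|s' s't E'] := @line_mean_value R n (partial i f) (a + s *: ei) ej t.
  by apply: (class_C_derivable (class_C_partial i fC)); exact: inU.
exists (a + s *: ei + s' *: ej); first exact: in_ball.
move: E; rewrite !scale0r !addr0 => ->; congr (_ * _).
by rewrite addrAC E'.
Qed.

Lemma partialC U f a (i j : 'I_n) :
  open U -> U a -> class_C 2 U f ->
  partial j (partial i f) a = partial i (partial j f) a.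
Proof.
move=> oU Ua fC.
have cont (k l : 'I_n) : {for a, continuous (partial l (partial k f))}.
  exact: class_C_continuous (class_C_partial l (class_C_partial k fC)) Ua.
apply/eqP; rewrite -subr_eq0 -normr_le0 leNgt; apply/negP => D0.
set D := `|_| in D0.
have D2 : 0 < D / 2 by rewrite divr_gt0.
have : \forall x \near a, [/\ U x,
    `|partial j (partial i f) x - partial j (partial i f) a| < D / 2 &
    `|partial i (partial j f) x - partial i (partial j f) a| < D / 2].
  have aU : nbhs a U by exact: open_nbhs_nbhs.
  have ij := (continuous_normP _ _).1 (cont i j) _ D2.
  have ji := (continuous_normP _ _).1 (cont j i) _ D2.
  by apply: filterS3 aU ij ji => x Ux xij xji; exact: And3 Ux xij xji.
move=> /near_normP[r r0 rP].
have t0 : 0 < r / 4 by rewrite divr_gt0.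
have tr : 2 * `|r / 4| < r.
  rewrite gtr0_norm // (_ : 2 * (r / 4) = r / 2); last by field.
  by rewrite ltr_pdivrMr // ltr_pMr // ltr1n.
have rU x : `|x - a| < r -> U x by move=> /rP[].
have [x xa Ex] := second_difference i j fC rU tr.
have [y ya Ey] := second_difference j i fC rU tr.
have {Ex Ey} E : partial j (partial i f) x = partial i (partial j f) y.
  apply: (mulIf (lt0r_neq0 t0)); apply: (mulIf (lt0r_neq0 t0)).
  apply: etrans (esym Ex) _; apply: etrans _ Ey.
  by rewrite (addrAC a) !opprB !addrA addrAC [in RHS]addrAC [X in X + _ = _]addrAC.
have [_ xD _] := rP x (le_lt_trans xa tr).
have [_ _ yD] := rP y (le_lt_trans ya tr).
have : D < D; last by rewrite ltxx.
rewrite {1}/D (_ : partial j (partial i f) a - _ =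
  (partial i (partial j f) y - partial i (partial j f) a) -
  (partial j (partial i f) x - partial j (partial i f) a)); last first.
  by rewrite E opprB [RHS]addrC addrA subrK.
rewrite [ltRHS]splitr; apply: le_lt_trans (ler_normB _ _) _; exact: ltrD yD xD.
Qed.

End symmetric_hessian.

Section class_C_algebra.
Context {R : realType} {n : nat} (U : set 'rV[R]_n) (oU : open U).
Implicit Types (f g : 'rV[R]_n -> R).

Lemma near_eq_on f g x : U x -> (forall y, U y -> f y = g y) ->
  \forall y \near x, f y = g y.
Proof.
move=> Ux fg; have : nbhs x U by exact: open_nbhs_nbhs.
by apply: filterS.
Qed.

Lemma class_C_ext k f g : (forall x, U x -> f x = g x) ->
  class_C k U f -> class_C k U g.
Proof.
have cont f' g' : (forall x, U x -> f' x = g' x) ->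
    (forall x, U x -> {for x, continuous f'}) ->
    forall x, U x -> {for x, continuous g'}.
  move=> fg f'c x Ux; apply/continuous_normP => e e0.
  have fx := (continuous_normP _ _).1 (f'c x Ux) e e0.
  by apply: filterS2 (near_eq_on Ux fg) fx => y <-; rewrite (fg x).
elim: k f g => [|k IH] f g fg [fc fd]; split=> //; try exact: cont fg fc.
move=> i; have [fi fp] := fd i; split=> [x Ux|].
  exact: near_eq_derivable (near_eq_on Ux fg) (fi x Ux).
apply: IH fp => x Ux; exact: near_eq_derive (near_eq_on Ux fg).
Qed.

Lemma class_C_intro k f (df : 'I_n -> 'rV[R]_n -> R) :
  (forall x, U x -> {for x, continuous f}) ->
  (forall x i, U x -> is_derive x (delta_mx 0 i) f (df i x)) ->
  (forall i, class_C k U (df i)) -> class_C k.+1 U f.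
Proof.
move=> fc fdf dfC; split=> // i; split=> [x Ux|].
  by have [] := fdf x i Ux.
by apply: class_C_ext (dfC i) => x Ux; have [_ <-] := fdf x i Ux.
Qed.

Lemma class_C_is_derive k f x i : class_C k.+1 U f -> U x ->
  is_derive x (delta_mx 0 i) f (partial i f x).
Proof. by move=> fC Ux; split=> //; exact: class_C_derivable fC Ux. Qed.

Lemma class_C_cst k (c : R) : class_C k U (fun=> c).
Proof.
elim: k c => [|k IH] c; first by split=> // x _; exact: cst_continuous.
apply: (@class_C_intro _ _ (fun _ _ => 0)) => // x *; exact: cst_continuous.
Qed.

Lemma class_C_coord k i : class_C k U (fun x => x 0 i).
Proof.
case: k => [|k]; first by split=> // x _; exact: coord_continuous.
apply: (@class_C_intro _ _ (fun j _ => (delta_mx 0 j : 'rV[R]_n) 0 i)).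
- by move=> x _; exact: coord_continuous.
- move=> x j _; apply/is_derive_approxP => e e0; near=> s.
  by rewrite !mxE /= [x 0 i + _]addrC addrK subrr normr0 mulr_ge0 // ltW.
- by move=> j; exact: class_C_cst.
Unshelve. all: by end_near. Qed.

Lemma class_CD k f g :
  class_C k U f -> class_C k U g -> class_C k U (fun x => f x + g x).
Proof.
elim: k f g => [|k IH] f g fC gC.
  split=> // x Ux; apply: continuousD.
    exact: class_C_continuous fC Ux.
  exact: class_C_continuous gC Ux.
apply: (@class_C_intro _ _ (fun i x => partial i f x + partial i g x)).
- move=> x Ux; apply: continuousD.
    exact: class_C_continuous fC Ux.
  exact: class_C_continuous gC Ux.
- by move=> x i Ux; apply: is_derive_addf; apply: class_C_is_derive Ux; eassumption.
- by move=> i; apply: IH; apply: class_C_partial; eassumption.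
Qed.

Lemma class_CM k f g :
  class_C k U f -> class_C k U g -> class_C k U (fun x => f x * g x).
Proof.
have cont k' f' g' : class_C k' U f' -> class_C k' U g' ->
    forall x, U x -> {for x, continuous (fun x => f' x * g' x)}.
  move=> f'C g'C x Ux; apply: continuousM.
    exact: class_C_continuous f'C Ux.
  exact: class_C_continuous g'C Ux.
elim: k f g => [|k IH] f g fC gC; first by split=> //; exact: cont fC gC.
apply: (@class_C_intro _ _ (fun i x => partial i f x * g x + f x * partial i g x)).
- exact: cont fC gC.
- by move=> x i Ux; apply: is_derive_mulf; apply: class_C_is_derive Ux; eassumption.
- move=> i; apply: class_CD; apply: IH.
  + exact: class_C_partial.
  + exact: class_CW.
  + exact: class_CW.
  + exact: class_C_partial.
Qed.

Lemma class_CN k f : class_C k U f -> class_C k U (fun x => - f x).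
Proof.
move=> fC; apply: (@class_C_ext k (fun x => -1 * f x)) => [x _|].
  by rewrite mulN1r.
by apply: class_CM fC; exact: class_C_cst.
Qed.

Lemma class_CV k f : (forall x, U x -> f x != 0) ->
  class_C k U f -> class_C k U (fun x => (f x)^-1).
Proof.
move=> f0; have cont k' : class_C k' U f ->
    forall x, U x -> {for x, continuous (fun x => (f x)^-1)}.
  move=> fC x Ux; apply: continuousV; first exact: f0.
  exact: class_C_continuous fC Ux.
elim: k => [|k IH] fC; first by split=> //; exact: cont fC.
apply: (@class_C_intro _ _ (fun i x => - (partial i f x * (f x)^-1 * (f x)^-1))).
- exact: cont fC.
- move=> x i Ux; apply: is_derive_invf; first exact: f0.
  exact: class_C_is_derive fC Ux.
- move=> i; apply: class_CN; apply: class_CM; last exact/IH/class_CW.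
  by apply: class_CM; [exact: class_C_partial|exact/IH/class_CW].
Qed.

Lemma class_C_sum k (I : Type) (s : seq I) (f : I -> 'rV[R]_n -> R) :
  (forall i, class_C k U (f i)) -> class_C k U (fun x => \sum_(i <- s) f i x).
Proof.
move=> fC; elim: s => [|i s IH].
  by apply: class_C_ext (class_C_cst k 0) => x _; rewrite big_nil.
by apply: class_C_ext (class_CD (fC i) IH) => x _; rewrite big_cons.
Qed.

End class_C_algebra.

Lemma row_continuous (R : realType) (V : normedModType R) n
    (c : V -> 'rV[R]_n) (a : V) :
  (forall i, {for a, continuous (fun x => c x 0 i)}) -> {for a, continuous c}.
Proof.
move=> cc; apply/continuous_normP => e e0.
have cci (i : 'I_n) : \forall x \near a, `|c x 0 i - c a 0 i| < e.
  by have /continuous_normP := cc i; exact.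
apply: filterS (filter_forall _ cci) => x xa; apply: norm_lt_coord => // i.
by rewrite !mxE.
Qed.

Lemma class_C_comp (R : realType) m n (U : set 'rV[R]_n) (W : set 'rV[R]_m)
    (f : 'rV[R]_m -> R) (c : 'rV[R]_n -> 'rV[R]_m) k :
  open U -> open W -> (forall x, U x -> W (c x)) ->
  (forall i, class_C k U (fun x => c x 0 i)) -> class_C k W f ->
  class_C k U (fun x => f (c x)).
Proof.
move=> oU oW cW.
have cont k' f' : (forall i, class_C k' U (fun x => c x 0 i)) ->
    class_C k' W f' -> forall x, U x -> {for x, continuous (fun x => f' (c x))}.
  move=> cC fC x Ux; apply: continuous_comp.
    by apply: row_continuous => i; exact: class_C_continuous (cC i) Ux.
  exact: class_C_continuous fC (cW _ Ux).
elim: k f => [|k IH] f cC fC; first by split=> //; exact: cont cC fC.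
apply: (@class_C_intro _ _ _ oU _ _ (fun i x =>
  \sum_j partial j f (c x) * partial i (fun y => c y 0 j) x)).
- exact: cont cC fC.
- move=> x i Ux; rewrite (_ : \sum_j _ =
    dot (grad f (c x)) (\row_j partial i (fun y => c y 0 j) x)); last first.
    by apply: eq_bigr => j _; rewrite !mxE.
  apply: strict_diff_comp => [|j].
    by apply: class_C_strict_diff oW (cW _ Ux) _; exact: class_C_le fC.
  by rewrite mxE; exact: class_C_is_derive (cC j) Ux.
- move=> i; apply: class_C_sum => // j; apply: class_CM => //.
    by apply: IH; [move=> l; exact/class_CW|exact: class_C_partial].
  exact: class_C_partial (cC j).
Qed.

Lemma dot_continuous (R : realType) (V : normedModType R) n
    (f g : V -> 'rV[R]_n) (x : V) :
  (forall i, {for x, continuous (fun y => f y 0 i)}) ->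
  (forall i, {for x, continuous (fun y => g y 0 i)}) ->
  {for x, continuous (fun y => dot (f y) (g y))}.
Proof.
move=> fc gc; rewrite /dot; elim: (index_enum _) => [|i l IH].
  rewrite (_ : (fun _ => _) = cst 0); first exact: cst_continuous.
  by apply: funext => y; rewrite big_nil.
rewrite (_ : (fun _ => _) =
  (fun y => f y 0 i * g y 0 i + \sum_(j <- l) f y 0 j * g y 0 j)).
  by apply: continuousD IH; apply: continuousM.
by apply: funext => y; rewrite big_cons.
Qed.

(** * Local inversion *)

(* Matrices have a norm and are complete; the join of both is declared here. *)
HB.instance Definition _ (R : realType) (m n : nat) :=
  Uniform_isComplete.Build 'M[R]_(m, n) (@mx_complete R m n).

Definition tangent_to_id (R : realType) (E : normedModType R) (F : E -> E)
    (a : E) := forall e : R, 0 < e ->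
  exists2 r : R, 0 < r & forall x y, `|x - a| < r -> `|y - a| < r ->
    `|F x - F y - (x - y)| <= e * `|x - y|.

(** The solution of F x = u is the fixed point of x |-> x - F x + u, which
    halves distances near a. *)
Lemma local_inverse (R : realType) (E : completeNormedModType R) (F : E -> E)
    (a : E) (r0 : R) : F a = a -> tangent_to_id F a -> 0 < r0 ->
  exists (rho r : R) (G : E -> E), [/\ 0 < rho <= r0, 0 < r,
    forall u, `|u - a| < r -> `|G u - a| < rho /\ F (G u) = u &
    forall x y, `|x - a| < rho -> `|y - a| < rho ->
      `|x - y| <= 2 * `|F x - F y| ].
Proof.
move=> Fa /(_ 2^-1 ltac:(by rewrite invr_gt0 ltr0n))[r1 r10 Fr] r00.
pose rho := Num.min r1 r0.
have rho0 : 0 < rho by rewrite lt_min r10.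
have rho1 : rho <= r1 by rewrite ge_min lexx.
have fixed_point u : `|u - a| < rho / 4 ->
    exists x, `|x - a| < rho /\ F x = u.
  move=> ua; pose B := [set x : E | `|x - a| <= rho / 2].
  have BE x : B x -> `|x - a| < rho.
    by move=> /le_lt_trans; apply; rewrite ltr_pdivrMr // ltr_pMr // ltr1n.
  have B1 x : B x -> `|x - a| < r1 by move=> /BE /lt_le_trans; exact.
  pose T (x : E) := x - F x + u.
  have TB : {homo T : x / B x >-> B x}.
    move=> x Bx; rewrite /B /=.
    have -> : T x - a = - (F x - F a - (x - a)) + (u - a).
      by rewrite /T Fa !opprB addrA addrA subrK -addrA.
    apply: le_trans (ler_normD _ _) _.
    have -> : rho / 2 = 2^-1 * (rho / 2) + rho / 4 by field.
    apply: lerD; last exact: ltW.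
    rewrite normrN; apply: le_trans (Fr _ _ (B1 _ Bx) _) _.
      by rewrite subrr normr0.
    by rewrite ler_wpM2l // invr_ge0 ler0n.
  have Tcontr : is_contraction (mkfun TB).
    exists (2^-1)%:nng; split=> /=; first by rewrite invf_lt1 // ltr1n.
    move=> [x y] /= [Bx By].
    rewrite /T (_ : _ - _ = - (F x - F y - (x - y))) ?normrN; last first.
      by rewrite opprB opprD addrACA subrr addr0 !opprD addrACA.
    exact: Fr (B1 _ Bx) (B1 _ By).
  have Bclosed : closed B.
    have -> : B = closed_ball a (rho / 2).
      rewrite closed_ballE ?divr_gt0 //; apply/seteqP; split=> x;
      by rewrite /B /closed_ball_ /= distrC.
    exact: closed_ball_closed.
  have B0 : B !=set0.
    by exists a; rewrite /B /= subrr normr0 divr_ge0 // ltW.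
  have [x Bx Tx] := banach_fixed_point Tcontr Bclosed B0.
  exists x; split; first exact: BE.
  have {}Tx : x = x - F x + u by [].
  move: Tx; rewrite -addrA -[X in X = _]addr0 => /addrI /eqP.
  by rewrite eq_sym addrC subr_eq0 => /eqP.
have /choice[G GP] : forall u, exists x, `|u - a| < rho / 4 ->
    `|x - a| < rho /\ F x = u.
  move=> u; have [/fixed_point[x xP]|_] := ltP `|u - a| (rho / 4).
    by exists x.
  by exists a.
exists rho, (rho / 4), G; split=> //.
- by rewrite rho0 ge_min lexx orbT.
- by rewrite divr_gt0.
move=> x y xa ya.
have := Fr x y (lt_le_trans xa rho1) (lt_le_trans ya rho1) => H.
have : `|x - y| <= `|F x - F y| + 2^-1 * `|x - y|.
  rewrite -{1}[x - y](subKr (F x - F y)).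
  by apply: le_trans (ler_normB _ _) _; rewrite lerD2l.
lra.
Qed.

(** * Charts of a hypersurface *)

Lemma continuous_closure_eq0 (R : realType) (V : normedModType R) (A : set V) (a : V)
    (f : V -> R) :
  closure A a -> {for a, continuous f} ->
  (\forall x \near a, A x -> f x = 0) -> f a = 0.
Proof.
move=> clA fa Af; apply/eqP; rewrite -normr_le0 leNgt; apply/negP => fa0.
have H : \forall x \near a, (A x -> f x = 0) /\ `|f x - f a| < `|f a|.
  by apply: filterI => //; exact: (continuous_normP _ _).1 fa _ fa0.
have [x [Ax [/(_ Ax) ->]]] := clA _ H.
by rewrite sub0r normrN ltxx.
Qed.

Lemma smooth_near_nbhs (R : realType) n (a : 'rV[R]_n) f :
  smooth_near a f -> \forall x \near a, smooth_near x f.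
Proof.
move=> [U [oU Ua] fC]; have : nbhs a U by exact: open_nbhs_nbhs.
by apply: filterS => x Ux; exists U.
Qed.

Lemma smooth_near_strict_diff (R : realType) n (a : 'rV[R]_n) f :
  smooth_near a f -> strict_diff f a (grad f a).
Proof. by move=> [U [oU Ua] fC]; exact: class_C_strict_diff oU Ua (fC 1%N). Qed.

Lemma strict_diff_is_derive (R : realType) n (f : 'rV[R]_n -> R) a w v :
  strict_diff f a w -> is_derive a v f (dot w v).
Proof.
move=> fa; apply: (@strict_diff_comp R _ n f id a v w v fa) => i.
apply/is_derive_approxP => e e0; near=> s.
by rewrite !mxE [a 0 i + _]addrC addrK subrr normr0 mulr_ge0 // ltW.
Unshelve. all: by end_near. Qed.

Lemma smooth_near_partial_continuous (R : realType) n (a : 'rV[R]_n) f i :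
  smooth_near a f -> {for a, continuous (partial i f)}.
Proof.
move=> [U [oU Ua] fC].
exact: class_C_continuous (class_C_partial i (fC 1%N)) Ua.
Qed.

Lemma grad_coordE (R : realType) n (f : 'rV[R]_n -> R) i :
  (fun x => grad f x 0 i) = partial i f.
Proof. by apply: funext => x; rewrite mxE. Qed.

Lemma kernel_colinear (R : realType) n (u w : 'rV[R]_n) (k : 'I_n) :
  w 0 k = 1 -> (forall v, dot w v = 0 -> dot u v = 0) -> u = u 0 k *: w.
Proof.
move=> wk H; apply/rowP => i; rewrite mxE.
have := H (delta_mx 0 i - w 0 i *: delta_mx 0 k).
rewrite !dotBr !dotZr !dot_delta wk mulr1 subrr => /(_ erefl) /eqP.
by rewrite subr_eq0 mulrC => /eqP.
Qed.

Section chart_functions.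
Context {R : realType} {d : nat}.
Implicit Types (S : set 'rV[R]_d.+1) (k : 'I_d.+1) (g : 'rV[R]_d -> R).
Implicit Types (x y z v w : 'rV[R]_d.+1).

Definition chart_fun k g y : R := y 0 k - g (col' k y).

(** Moves y along the k-th axis onto the graph of g. *)
Definition chart_proj k g y : 'rV[R]_d.+1 :=
  y - chart_fun k g y *: delta_mx 0 k.

Lemma col'_delta k : col' k (delta_mx 0 k : 'rV[R]_d.+1) = 0.
Proof. by apply/rowP => j; rewrite !mxE eq_sym (negPf (neq_lift k j)). Qed.

Lemma chart_fun_proj k g y : chart_fun k g (chart_proj k g y) = 0.
Proof.
have colE : col' k (chart_proj k g y) = col' k y.
  apply/rowP => j; have /rowP/(_ j) := col'_delta k; rewrite !mxE => ->.
  by rewrite mulr0 subr0.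
rewrite {1}/chart_fun colE !mxE !eqxx mulr1 /chart_fun opprB addrA addrAC.
by rewrite subrr add0r subrr.
Qed.

Lemma col'_continuous k : continuous (fun y : 'rV[R]_d.+1 => col' k y).
Proof.
move=> y; apply: row_continuous => j.
rewrite (_ : (fun _ => _) = (fun x : 'rV[R]_d.+1 => x 0 (lift k j))).
  exact: coord_continuous.
by apply: funext => x; rewrite mxE.
Qed.

Lemma smooth_near_chart_fun k g x :
  smooth_near (col' k x) g -> smooth_near x (chart_fun k g).
Proof.
move=> [U [oU Ux] gC]; pose W := (fun y => col' k y) @^-1` U.
have oW : open W by apply: open_comp => // y _; exact: col'_continuous.
exists W => // m; apply: class_CD => //; first exact: class_C_coord.
apply: class_CN => //; apply: class_C_comp (gC m) => // j.
by apply: class_C_ext (class_C_coord oW m (lift k j)) => // y _; rewrite mxE.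
Qed.

Lemma dot_grad_chart_fun k g x v : smooth_near (col' k x) g ->
  dot (grad (chart_fun k g) x) v = v 0 k - dot (grad g (col' k x)) (col' k v).
Proof.
move=> gs.
have [_ <-] := strict_diff_is_derive v
  (smooth_near_strict_diff (smooth_near_chart_fun gs)).
have dcoord (i : 'I_d.+1) : is_derive x v (fun y : 'rV[R]_d.+1 => y 0 i) (v 0 i).
  apply/is_derive_approxP => e e0; near=> s.
  by rewrite !mxE [x 0 i + _]addrC addrK subrr normr0 mulr_ge0 // ltW.
suff [] : is_derive x v (chart_fun k g)
  (v 0 k - dot (grad g (col' k x)) (col' k v)) by [].
apply: is_derive_subf => //.
apply: (strict_diff_comp (smooth_near_strict_diff gs)) => j.
by under eq_fun do rewrite mxE; rewrite mxE.
Unshelve. all: by end_near. Qed.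

Lemma grad_chart_fun_axis k g x : smooth_near (col' k x) g ->
  grad (chart_fun k g) x 0 k = 1.
Proof.
move=> gs; rewrite -dot_delta dot_grad_chart_fun // col'_delta dot0r subr0.
by rewrite mxE !eqxx.
Qed.

Lemma chart_proj_continuous k g x : smooth_near (col' k x) g ->
  {for x, continuous (chart_proj k g)}.
Proof.
move=> /smooth_near_chart_fun/smooth_near_strict_diff/strict_diff_continuous gc.
apply: row_continuous => i; rewrite (_ : (fun _ => _) =
  (fun y => y 0 i - chart_fun k g y * (delta_mx 0 k : 'rV[R]_d.+1) 0 i)).
  apply: continuousB; first exact: coord_continuous.
  by apply: continuousM => //; exact: cst_continuous.
by apply: funext => y; rewrite !mxE.
Qed.

Lemma graph_chart_near S x k g : graph_chart S x k g ->
  \forall z \near x, S z -> graph_chart S z k g.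
Proof.
move=> [gs xg Sg].
have gs' : \forall z \near x, smooth_near (col' k z) g.
  exact: (@col'_continuous k x _ (smooth_near_nbhs gs)).
apply: filterS2 gs' (near_join Sg) => z zs Sz zS; split=> //.
exact: nbhs_singleton Sz zS.
Qed.

Lemma graph_chart_smooth S x k g :
  graph_chart S x k g -> smooth_near x (chart_fun k g).
Proof. by case=> gs _ _; exact: smooth_near_chart_fun. Qed.

Lemma graph_chart_near0 S x k g : graph_chart S x k g ->
  \forall y \near x, S y -> chart_fun k g y = 0.
Proof.
move=> [_ _]; apply: filterS => y Sy /Sy yg.
by rewrite /chart_fun yg subrr.
Qed.

Lemma tangent_vectorP S x v : tangent_vector S x v <->
  exists k g, graph_chart S x k g /\ dot (grad (chart_fun k g) x) v = 0.
Proof.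
split=> -[k [g [c H]]]; exists k, g; split=> //; have [gs _ _] := c.
  by rewrite dot_grad_chart_fun // H subrr.
by move/eqP: H; rewrite dot_grad_chart_fun // subr_eq0 => /eqP.
Qed.

(** The curve in the graph is the projection of a straight line. *)
Lemma graph_in_zeros_tangent (f : 'rV[R]_d.+1 -> R) k g z w v :
  strict_diff f z w -> smooth_near (col' k z) g -> chart_fun k g z = 0 ->
  (\forall y \near z, chart_fun k g y = 0 -> f y = 0) ->
  dot (grad (chart_fun k g) z) v = 0 -> dot w v = 0.
Proof.
move=> fw gs z0 f0 v0.
pose c (t : R) := chart_proj k g (z + t *: v).
have line i : is_derive (0 : R) 1 (fun t => (z + t *: v) 0 i) (v 0 i).
  apply/(@is_derive_approxP _ R^o) => e e0; near=> s.
  rewrite !mxE add0r mul0r addr0 /GRing.scale /= mulr1 [_ + s * _]addrC addrK.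
  by rewrite subrr normr0 mulr_ge0 // ltW.
have c0 : c 0 = z.
  by rewrite /c scale0r addr0 /chart_proj z0 scale0r subr0.
have dc i : is_derive (0 : R) 1 (fun t => c t 0 i) (v 0 i).
  have -> : (fun t => c t 0 i) = (fun t => (z + t *: v) 0 i -
      chart_fun k g (z + t *: v) * (delta_mx 0 k : 'rV[R]_d.+1) 0 i).
    by apply: funext => t; rewrite [c t 0 i]mxE; congr (_ + _); rewrite !mxE.
  have -> : v 0 i = v 0 i - (dot (grad (chart_fun k g) z) v *
        (delta_mx 0 k : 'rV[R]_d.+1) 0 i + chart_fun k g (z + 0 *: v) * 0).
    by rewrite v0 mul0r mulr0 add0r subr0.
  apply: (is_derive_subf (line i)).
  apply: is_derive_mulf.
  apply: (@strict_diff_comp _ R^o) => //.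
  rewrite scale0r addr0.
  exact: smooth_near_strict_diff (smooth_near_chart_fun gs).
have cc : {for 0, continuous c}.
  apply: row_continuous => i; apply: differentiable_continuous.
  by apply/derivable1_diffP; have [] := dc i.
have fc : is_derive (0 : R) 1 (fun t => f (c t)) (dot w v).
  by apply: (@strict_diff_comp _ R^o) => //; rewrite c0.
have fc0 : is_derive (0 : R) 1 (fun t => f (c t)) 0.
  have cz : c t @[t --> (0 : R)] --> z by rewrite -[X in _ --> X]c0; exact: cc.
  have fcE : \forall t \near (0 : R), (cst 0 : R -> R) t = f (c t).
    suff: \forall t \near (0 : R), f (c t) = 0 by apply: filterS => t ->.
    have : \forall t \near (0 : R), chart_fun k g (c t) = 0 -> f (c t) = 0.
      exact: cz _ f0.
    by apply: filterS => t; apply; exact: chart_fun_proj.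
  exact: near_eq_is_derive fcE (is_derive_cst (0 : R) (0 : R) (1 : R)).
by have [_ <-] := fc; have [_ ->] := fc0.
Unshelve. all: by end_near. Qed.

Lemma interior_pointP S z : interior_point S z -> S z /\ exists k g,
  [/\ smooth_near (col' k z) g, chart_fun k g z = 0 &
      \forall y \near z, S y <-> chart_fun k g y = 0].
Proof.
move=> [Sz [k [g [gs Sg]]]]; split=> //; exists k, g; split=> //.
  by rewrite /chart_fun -(nbhs_singleton Sg).1 // subrr.
apply: filterS Sg => y ->; rewrite /chart_fun.
by split=> [->|/eqP]; rewrite ?subrr // subr_eq0 => /eqP.
Qed.

Lemma graph_chart_interior_colinear S z k g k' g' :
  graph_chart S z k g -> smooth_near (col' k' z) g' -> chart_fun k' g' z = 0 ->
  (\forall y \near z, S y <-> chart_fun k' g' y = 0) ->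
  grad (chart_fun k g) z =
    grad (chart_fun k g) z 0 k' *: grad (chart_fun k' g') z.
Proof.
move=> c gs' z0 Sg; apply: kernel_colinear; first exact: grad_chart_fun_axis.
move=> v; apply: graph_in_zeros_tangent => //.
  exact/smooth_near_strict_diff/graph_chart_smooth/c.
by apply: filterS2 Sg (graph_chart_near0 c) => y Sy yS /Sy.
Qed.

(** Both gradients are multiples of the same vector at the interior points
    of S, and these accumulate at x. *)
Lemma chart_independence S x k g k' g' v : hypersurface S -> S x ->
  graph_chart S x k g -> graph_chart S x k' g' ->
  dot (grad (chart_fun k g) x) v = 0 -> dot (grad (chart_fun k' g') x) v = 0.
Proof.
move=> [_ _ clS] Sx c c'.
have minor i j : grad (chart_fun k g) x 0 i * grad (chart_fun k' g') x 0 j -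
    grad (chart_fun k g) x 0 j * grad (chart_fun k' g') x 0 i = 0.
  pose D y := partial i (chart_fun k g) y * partial j (chart_fun k' g') y -
    partial j (chart_fun k g) y * partial i (chart_fun k' g') y.
  rewrite !mxE -/(D x); apply: (continuous_closure_eq0 (clS _ Sx)).
    have C l : {for x, continuous (partial l (chart_fun k g))}.
      exact: smooth_near_partial_continuous (graph_chart_smooth c).
    have C' l : {for x, continuous (partial l (chart_fun k' g'))}.
      exact: smooth_near_partial_continuous (graph_chart_smooth c').
    apply: continuousB; apply: continuousM.
    - exact: C.
    - exact: C'.
    - exact: C.
    - exact: C'.
  apply: filterS2 (graph_chart_near c) (graph_chart_near c') => z zc zc'.
  move=> /interior_pointP[Sz [k2 [g2 [gs2 z0 Sg2]]]].
  have E := graph_chart_interior_colinear (zc Sz) gs2 z0 Sg2.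
  have E' := graph_chart_interior_colinear (zc' Sz) gs2 z0 Sg2.
  set w := grad (chart_fun k2 g2) z in E E'.
  have P l : partial l (chart_fun k g) z = grad (chart_fun k g) z 0 k2 * w 0 l.
    by transitivity (grad (chart_fun k g) z 0 l); [rewrite mxE|rewrite {1}E mxE].
  have P' l :
      partial l (chart_fun k' g') z = grad (chart_fun k' g') z 0 k2 * w 0 l.
    by transitivity (grad (chart_fun k' g') z 0 l); [rewrite mxE|rewrite {1}E' mxE].
  by rewrite /D !P !P'; ring.
have -> : grad (chart_fun k' g') x =
    grad (chart_fun k' g') x 0 k *: grad (chart_fun k g) x.
  apply/rowP => j; rewrite [RHS]mxE mulrC; have := minor k j.
  have [gs _ _] := c; rewrite grad_chart_fun_axis // mul1r => /eqP.
  by rewrite subr_eq0 => /eqP.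
by rewrite dotZl => ->; rewrite mulr0.
Qed.

(** The projection of y onto the local graph of S lies in S, so the chart
    function vanishes at both points; as it is strictly monotone along the
    axis of projection, the points coincide. *)
Lemma interior_point_graph S z k g :
  graph_chart S z k g -> interior_point S z ->
  \forall y \near z, chart_fun k g y = 0 -> S y.
Proof.
move=> c /interior_pointP[Sz [k' [g' [gs' z0 Sg']]]].
have E := graph_chart_interior_colinear c gs' z0 Sg'.
set a := grad (chart_fun k g) z 0 k' in E.
have a0 : a != 0.
  apply/eqP => a0; have [gs _ _] := c; have := grad_chart_fun_axis gs.
  by rewrite E a0 scale0r mxE => /eqP; rewrite eq_sym oner_eq0.
have [r r0 fr] := smooth_near_strict_diff (graph_chart_smooth c)
  (e := `|a| / 2) ltac:(by rewrite divr_gt0 ?normr_gt0).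
have zb : \forall y \near z, `|y - z| < r by apply/near_normP; exists r.
have pz : chart_proj k' g' z = z by rewrite /chart_proj z0 scale0r subr0.
have pc : chart_proj k' g' y @[y --> z] --> z.
  by rewrite -[X in _ --> X]pz; exact: chart_proj_continuous.
have pP : \forall y \near z, let p := chart_proj k' g' y in
    `|p - z| < r /\ (S p <-> chart_fun k' g' p = 0) /\
    (S p -> chart_fun k g p = 0).
  exact: pc _ (filterI zb (filterI Sg' (graph_chart_near0 c))).
apply: filterS3 zb Sg' pP => y yr Sy [pr [Sp pS]] y0; apply/Sy.
have {}p0 : chart_fun k g (chart_proj k' g' y) = 0.
  by apply/pS/Sp; rewrite chart_fun_proj.
have := fr _ _ yr pr; rewrite y0 p0 subrr sub0r normrN.
rewrite /chart_proj opprB [y + _]addrC subrK dotZr dot_delta -/a normrM normrZ.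
set t := `|chart_fun k' g' y|.
have norm_delta : `|delta_mx 0 k' : 'rV[R]_d.+1| <= 1.
  apply: norm_le_coord => // l; rewrite mxE.
  by case: (_ && _); rewrite ?normr1 ?normr0.
move=> H; apply/eqP; rewrite -normr_le0 -/t leNgt; apply/negP => t0.
have : t * `|a| <= `|a| / 2 * t.
  apply: le_trans H _; rewrite ler_wpM2l ?divr_ge0 //.
  by rewrite ler_piMr // ltW.
rewrite mulrC ler_pM2r // leNgt ltr_pdivrMr // ltr_pMr ?normr_gt0 //.
by rewrite ltr1n.
Qed.

End chart_functions.

(** * Linear algebra of normals *)

Section spans.
Context {R : realType} {n s : nat} (nu : 'I_s -> 'rV[R]_n).
Implicit Types (J : {set 'I_s}) (al v : 'rV[R]_n).

(** The row space of a matrix is the annihilator of its kernel. *)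
Lemma span_of_kernel J al :
  (forall v, (forall j, j \in J -> dot (nu j) v = 0) -> dot al v = 0) ->
  exists2 a : 'I_s -> R, al = \sum_(j in J) a j *: nu j &
    forall j, j \notin J -> a j = 0.
Proof.
move=> H; pose M := \matrix_(j < s) (if j \in J then nu j else 0).
have dotE u v : dot u v = (u *m v^T) 0 0.
  by rewrite mxE; apply: eq_bigr => i _; rewrite mxE.
have : (al <= M)%MS.
  rewrite submxE; apply/eqP/rowP => k; rewrite [RHS]mxE.
  pose v := (col k (cokermx M))^T.
  have colE (u : 'rV[R]_n) : (u *m cokermx M) 0 k = dot u v.
    rewrite mxE; apply: eq_bigr => l _; by rewrite !mxE.
  rewrite colE; apply: H => j jJ; rewrite -colE.
  have <- : row j M = nu j by rewrite rowK jJ.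
  by rewrite -row_mul mulmx_coker !mxE.
move=> /submxP[D ->]; exists (fun j => if j \in J then D 0 j else 0) => [|j].
  rewrite mulmx_sum_row [RHS]big_mkcond; apply: eq_bigr => j _.
  by rewrite rowK; case: ifP; rewrite ?scaler0.
by move=> /negPf ->.
Qed.

(** If one of the vectors vanished on the common kernel of the others, it would
    be a combination of them. *)
Lemma dual_basis J :
  (forall a : 'I_s -> R, \sum_(j in J) a j *: nu j = 0 ->
    forall j, j \in J -> a j = 0) ->
  exists w : 'I_s -> 'rV[R]_n, forall i j, i \in J -> j \in J ->
    dot (nu i) (w j) = (i == j)%:R.
Proof.
move=> free.
suff /choice[w wP] : forall j, exists w, forall i, i \in J -> j \in J ->
    dot (nu i) w = (i == j)%:R.
  by exists w => i j iJ jJ; exact: wP.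
move=> j; have [jJ|jJ] := boolP (j \in J); last by exists 0.
have [[v vJ vj]|none] := pselect (exists2 v,
    (forall i, i \in J :\ j -> dot (nu i) v = 0) & dot (nu j) v != 0).
  exists ((dot (nu j) v)^-1 *: v) => i iJ _; rewrite dotZr.
  have [->|ij] := eqVneq i j; first by rewrite mulVf.
  by rewrite (vJ i) ?mulr0 // finset.in_setD1 ij.
have kerE u : (forall i, i \in J :\ j -> dot (nu i) u = 0) -> dot (nu j) u = 0.
  move=> Hu; apply/eqP; apply: contrapT => /negP uj.
  by apply: none; exists u.
have [a aE _] := span_of_kernel kerE.
have comb0 : \sum_(i in J) (if i == j then -1 else a i) *: nu i = 0.
  rewrite (finset.big_setD1 j) //= eqxx {1}aE scaleN1r -sumrN -big_split /= big1 //.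
  by move=> i; rewrite finset.in_setD1 => /andP[/negPf -> _]; rewrite addNr.
have /eqP := free _ comb0 j jJ.
by rewrite eqxx oppr_eq0 oner_eq0.
Qed.

End spans.

(** * Strata of the singular hypersurface *)

Section straightening.
Context {R : realType} {n s : nat} (phi : 'I_s -> 'rV[R]_n -> R) (x0 : 'rV[R]_n).
Variable J : {set 'I_s}.
Let nu j := grad (phi j) x0.
Hypothesis phi0 : forall j, j \in J -> phi j x0 = 0.
Hypothesis phi_smooth : forall j, j \in J -> smooth_near x0 (phi j).
Hypothesis nu_free : forall a : 'I_s -> R, \sum_(j in J) a j *: nu j = 0 ->
  forall j, j \in J -> a j = 0.

Lemma tangent_to_id_add (F : 'rV[R]_n -> 'rV[R]_n) f w (v : 'rV[R]_n) :
  tangent_to_id F x0 -> strict_diff f x0 w ->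
  tangent_to_id (fun x => F x + (f x - dot w (x - x0)) *: v) x0.
Proof.
move=> Fx fx e e0; have e20 : 0 < e / 2 by rewrite divr_gt0.
pose c := e / 2 / (`|v| + 1).
have v1 : 0 < `|v| + 1 by rewrite ltr_wpDl.
have [r1 r10 Fr] := Fx _ e20.
have [r2 r20 fr] := fx c ltac:(by rewrite divr_gt0).
exists (Num.min r1 r2) => [|x y]; first by rewrite lt_min r10.
rewrite !lt_min => /andP[x1 x2] /andP[y1 y2].
have -> : F x + (f x - dot w (x - x0)) *: v -
    (F y + (f y - dot w (y - x0)) *: v) - (x - y) =
    (F x - F y - (x - y)) + (f x - f y - dot w (x - y)) *: v.
  rewrite opprD addrACA -scalerBl [LHS]addrAC; congr (_ + _ *: _).
  by rewrite !dotBr; ring.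
apply: le_trans (ler_normD _ _) _.
rewrite (splitr e) mulrDl lerD ?Fr // normrZ.
apply: le_trans (ler_wpM2r _ (fr _ _ x2 y2)) _; first exact: normr_ge0.
rewrite mulrAC ler_wpM2r // /c mulrAC ler_pdivrMr //.
by rewrite ler_wpM2l ?lerDl // ltW.
Qed.

(** Correcting the identity along a dual basis of the normals replaces the
    linear part of each phi j by phi j itself: in the coordinates u = F x all
    the zero sets become hyperplanes at once. *)
Lemma straightening (r0 : R) : 0 < r0 ->
  exists (F G : 'rV[R]_n -> 'rV[R]_n) (rho r : R),
  [/\ 0 < rho <= r0, 0 < r,
     [/\ forall x j, j \in J -> dot (nu j) (F x - x0) = phi j x,
         F x0 = x0 & tangent_to_id F x0],
     forall u, `|u - x0| < r -> `|G u - x0| < rho /\ F (G u) = u &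
     forall x y, `|x - x0| < rho -> `|y - x0| < rho ->
      `|x - y| <= 2 * `|F x - F y| ].
Proof.
move=> r00; have [w wP] := dual_basis nu_free.
pose F x := x + \sum_(j in J) (phi j x - dot (nu j) (x - x0)) *: w j.
have F0 : F x0 = x0.
  rewrite /F big1 ?addr0 // => j jJ.
  by rewrite phi0 // subrr dot0r subr0 scale0r.
have FJ x j : j \in J -> dot (nu j) (F x - x0) = phi j x.
  move=> jJ; rewrite /F addrAC dotDr dot_sumr (bigD1 j) //= dotZr wP // eqxx.
  rewrite big1 => [|i /andP[iJ ij]].
    by rewrite mulr1 addr0 [LHS]addrC subrK.
  by rewrite dotZr wP // eq_sym (negPf ij) mulr0.
have Fid : tangent_to_id F x0.
  rewrite /F; elim: (index_enum _) => [|j l IH] e e0.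
    exists 1 => // x y _ _; rewrite !big_nil !addr0 subrr normr0.
    by rewrite mulr_ge0 // ltW.
  have [jJ|jJ] := boolP (j \in J); last first.
    have [r rpos rP] := IH e e0; exists r => // x y xr yr.
    by rewrite !big_cons (negPf jJ); exact: rP.
  have [r rpos rP] := tangent_to_id_add (w j) IH
    (smooth_near_strict_diff (phi_smooth jJ)) e0.
  exists r => // x y xr yr; have := rP x y xr yr.
  have E z (u v : 'rV[R]_n) : z + (u + v) = z + v + u by rewrite addrCA addrC.
  by rewrite !big_cons jJ !E.
have [rho [r [G [rho0 rpos Gu Fxy]]]] := local_inverse F0 Fid r00.
by exists F, G, rho, r; split.
Qed.

(** The curve is a line in the straightened coordinates. *)
Lemma zero_set_curve (v : 'rV[R]_n) :
  (forall j, j \in J -> dot (nu j) v = 0) ->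
  exists c : R -> 'rV[R]_n, [/\ c 0 = x0,
    forall i, is_derive (0 : R) 1 (fun t => c t 0 i) (v 0 i) &
    \forall t \near (0 : R), forall j, j \in J -> phi j (c t) = 0].
Proof.
move=> vJ; have [F [G [rho [r [rho0 r0 [FJ F0 Fid] Gu Fxy]]]]] :=
  straightening ltr01.
have Gx0 : G x0 = x0.
  have [|Gr FG] := Gu x0; first by rewrite subrr normr0.
  apply/eqP; rewrite -subr_eq0 -normr_le0; apply: le_trans (Fxy _ _ Gr _) _.
    by rewrite subrr normr0; case/andP: rho0.
  by rewrite FG F0 subrr normr0 mulr0.
have v1 : 0 < `|v| + 1 by rewrite ltr_wpDl.
have tr (e : R) : 0 < e -> \forall t \near (0 : R), `|t *: v| < e.
  move=> e0; apply/(@near_normP R R^o); exists (e / (`|v| + 1)).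
    by rewrite divr_gt0.
  move=> t; rewrite subr0 ltr_pdivlMr // normrZ; apply: le_lt_trans.
  by rewrite ler_wpM2l // lerDl.
exists (fun t => G (x0 + t *: v)); split.
- by rewrite scale0r addr0.
- move=> i; apply/(@is_derive_approxP _ R^o) => e e0.
  have e'0 : 0 < e / (2 * (`|v| + 1)) by rewrite divr_gt0 // mulr_gt0.
  have [r1 r10 Fr] := Fid _ e'0.
  have rr : 0 < Num.min r (r1 / 2) by rewrite lt_min r0 divr_gt0.
  apply: filterS (tr _ rr) => t; rewrite lt_min => /andP[tv tv1].
  have -> : 0 + t *: (1 : R^o) = t by rewrite add0r /GRing.scale /= mulr1.
  rewrite scale0r addr0 Gx0.
  have [|] := Gu (x0 + t *: v); first by rewrite addrC addKr.
  set x := G _ => xr Fx.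
  have xx0 : `|x - x0| <= 2 * `|t *: v|.
    apply: le_trans (Fxy _ _ xr _) _.
      by rewrite subrr normr0; case/andP: rho0.
    by rewrite Fx F0 addrC addKr.
  have := Fr x x0; rewrite Fx F0 subrr normr0.
  rewrite [x0 + _]addrC addrK => /(_ _ r10) H.
  apply: le_trans (_ : `|t *: v - (x - x0)| <= _).
    rewrite distrC; apply: le_trans (coord_le_norm _ i).
    by rewrite !mxE.
  apply: le_trans (H _) _.
    by apply: le_lt_trans xx0 _; rewrite mulrC -ltr_pdivlMr.
  apply: le_trans (ler_wpM2l (ltW e'0) xx0) _.
  have -> : e / (2 * (`|v| + 1)) * (2 * `|t *: v|) =
      e * `|t| * (`|v| / (`|v| + 1)).
    by rewrite normrZ; field; rewrite lt0r_neq0.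
  have et0 : 0 <= e * `|t| by rewrite mulr_ge0 // ltW.
  by apply: ler_piMr => //; rewrite ler_pdivrMr // mul1r lerDl.
- apply: filterS (tr _ r0) => t tv j jJ.
  have [|_ FG] := Gu (x0 + t *: v); first by rewrite addrC addKr.
  by rewrite -FJ // FG addrC addKr dotZr vJ // mulr0.
Qed.

End straightening.

(** The times in [0, 1[ at which c is in S form an open and closed subset. *)
Lemma segment_invariant (R : realType) (V : normedModType R) (c : R -> V)
    (S : set V) (P : V -> Prop) (K : R) :
  closed S -> S (c 0) ->
  (forall t u, 0 <= t <= 1 -> 0 <= u <= 1 -> `|c t - c u| <= K * `|t - u|) ->
  (forall t, 0 <= t <= 1 -> P (c t)) ->
  (forall t, 0 <= t < 1 -> S (c t) -> \forall y \near c t, P y -> S y) ->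
  S (c 1).
Proof.
move=> clS S0 Kc Pc openS.
pose L := `|K| + 1.
have L0 : 0 < L by rewrite ltr_wpDl.
have Lc t u : 0 <= t <= 1 -> 0 <= u <= 1 -> `|c t - c u| <= L * `|t - u|.
  move=> t01 u01; apply: le_trans (Kc t u t01 u01) _; rewrite ler_wpM2r //.
  by apply: le_trans (ler_norm K) _; rewrite lerDl.
pose A := [set t : R | 0 <= t < 1 /\ S (c t)].
have A01 t : A t -> 0 <= t <= 1 by move=> [/andP[t0 /ltW t1] _]; rewrite t0.
have near_c t (Q : set V) : 0 <= t <= 1 -> (\forall y \near c t, Q y) ->
    exists2 e : R, 0 < e & forall u, 0 <= u <= 1 -> `|u - t| < e -> Q (c u).
  move=> t01 /near_normP[e e0 eQ]; exists (e / L); first by rewrite divr_gt0.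
  move=> u u01 ut; apply: eQ; apply: le_lt_trans (Lc u t u01 t01) _.
  by rewrite mulrC -ltr_pdivlMr.
have clA t : 0 <= t <= 1 -> closure A t -> S (c t).
  move=> t01 At; apply: clS => Q /near_c -/(_ t01)[e e0 eQ].
  have [u [Au ut]] := At [set u | `|u - t| < e] ltac:(by
    apply/(@near_normP R R^o); exists e).
  by exists (c u); split; [case: Au|apply: eQ => //; exact: A01].
have AE : A = `[0, 1[%classic.
  have := @connected_intervalP R `[0, 1[%classic; case=> _ /(_ _) conn.
  apply: (conn _ A) => [|||].
  - exact: interval_is_interval.
  - by exists 0; split; rewrite // lexx ltr01.
  - exists [set t | \forall u \near t, 0 <= u < 1 -> A u].
      rewrite openE => t /= tA; exact: near_join tA.
    apply/seteqP; split=> [t At|t [/= t01 At]]; last first.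
      by apply: (nbhs_singleton At); move: t01; rewrite in_itv.
    have [t01 St] := At; split; first by rewrite /= in_itv.
    have [e e0 eS] := near_c t _ (A01 _ At) (openS t t01 St).
    apply/(@near_normP R R^o); exists e => // u ut u01; split=> //.
    have u01' : 0 <= u <= 1 by case/andP: u01 => -> /ltW.
    by apply: eS => //; exact: Pc.
  - exists (closure A); first exact: closed_closure.
    apply/seteqP; split=> [t At|t [/= t01 At]].
      by split; [rewrite /= in_itv /=; case: At|exact: subset_closure].
    move: t01; rewrite in_itv /= => t01; split=> //; apply: clA => //.
    by case/andP: t01 => -> /ltW.
apply: clA; first by rewrite ler01 lexx.
move=> Q /(@near_normP R R^o)[e e0 eQ].
pose u := Num.max 0 (1 - e / 2).
have u1 : u < 1 by rewrite gt_max ltr01 /= ltrBlDr ltrDl divr_gt0.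
exists u; split; first by rewrite AE /= in_itv /= le_max lexx u1.
apply: eQ; rewrite distrC gtr0_norm ?subr_gt0 // ltrBlDr -ltrBlDl.
by rewrite lt_max ltrD2l ltrN2 ltr_pdivrMr // ltr_pMr // ltr1n orbT.
Qed.

Section local_frames.
Context {R : realType} {d s : nat} (Gam : 'I_s -> set 'rV[R]_d.+1).

(** The last field says more than a choice of charts: pieces may have edges, but
    the stratum of the pieces through x0 has none near x0. *)
Record local_frame (x0 : 'rV[R]_d.+1) (J : {set 'I_s})
    (phi : 'I_s -> 'rV[R]_d.+1 -> R) : Prop := {
  frame_index : forall i, i \in J <-> Gam i x0;
  frame_smooth : forall j, j \in J -> smooth_near x0 (phi j);
  frame_zero : forall j, j \in J -> phi j x0 = 0;
  frame_free : forall a : 'I_s -> R,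
    \sum_(j in J) a j *: grad (phi j) x0 = 0 -> forall j, j \in J -> a j = 0;
  frame_sub : \forall x \near x0, forall i, Gam i x -> i \in J /\ phi i x = 0;
  frame_tangent : \forall x \near x0, forall i, Gam i x ->
    forall v, tangent_vector (Gam i) x v <-> dot (grad (phi i) x) v = 0;
  frame_common : \forall x \near x0,
    (forall j, j \in J -> phi j x = 0) -> forall j, j \in J -> Gam j x
}.

Hypothesis Gam_hyp : forall j, hypersurface (Gam j).
Hypothesis Gam_edges : forall j x, Gam j x -> ~ interior_point (Gam j) x ->
  exists2 i, i != j & Gam i x.
Hypothesis Gam_position : general_position Gam.

(** Near x0 each piece is cut out of its chart by the other pieces only, so it
    contains every point that all of the defining functions annihilate: join
    the point, inside the chart of the piece, to an interior point of the
    piece by a path that meets none of the other charts before it ends. *)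
Lemma local_frame_exists x0 : exists J phi, local_frame x0 J phi.
Proof.
have /choice[kg kgP] : forall j, exists kg : 'I_d.+1 * ('rV[R]_d -> R),
    Gam j x0 -> graph_chart (Gam j) x0 kg.1 kg.2.
  move=> j; have [jx|jx] := pselect (Gam j x0); last by exists (ord0, cst 0).
  by have [_ /(_ _ jx)[k [g c]] _] := Gam_hyp j; exists (k, g).
pose phi j := chart_fun (kg j).1 (kg j).2.
pose J := [set j | `[< Gam j x0 >]]%SET.
have JP j : j \in J <-> Gam j x0 by rewrite finset.inE; split=> /asboolP.
have c j : j \in J -> graph_chart (Gam j) x0 (kg j).1 (kg j).2.
  by move=> /JP; exact: kgP.
have phi_smooth j : j \in J -> smooth_near x0 (phi j).
  by move=> /c; exact: graph_chart_smooth.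
have phi0 j : j \in J -> phi j x0 = 0.
  by move=> jJ; have := nbhs_singleton (graph_chart_near0 (c j jJ)) ((JP j).1 jJ).
have free (a : 'I_s -> R) : \sum_(j in J) a j *: grad (phi j) x0 = 0 ->
    forall j, j \in J -> a j = 0.
  apply: (@Gam_position J x0) => [j /JP//|j jJ]; split.
    apply/eqP => g0; have [gs _ _] := c j jJ.
    have := grad_chart_fun_axis gs; rewrite -/(phi j) g0 mxE => /eqP.
    by rewrite eq_sym oner_eq0.
  move=> v /tangent_vectorP[k [g [c']]].
  exact: chart_independence (Gam_hyp j) ((JP j).1 jJ) c' (c j jJ).
have chart_near : \forall x \near x0, forall i, Gam i x ->
    i \in J /\ graph_chart (Gam i) x (kg i).1 (kg i).2.
  suff H (i : 'I_s) : \forall x \near x0, Gam i x ->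
      i \in J /\ graph_chart (Gam i) x (kg i).1 (kg i).2.
    exact: filter_forall H.
  have [iJ|iJ] := boolP (i \in J).
    by apply: filterS (graph_chart_near (c i iJ)) => x cx ix; split; last exact: cx.
  have : nbhs x0 (~` Gam i).
    apply: open_nbhs_nbhs; split; last by move=> /JP; exact/negP.
    by apply: closed_openC; have [] := Gam_hyp i.
  by apply: filterS => x ix /ix.
have sub_near : \forall x \near x0, forall i, Gam i x -> i \in J /\ phi i x = 0.
  apply: filterS chart_near => x cx i ix; have [iJ ci] := cx i ix; split=> //.
  exact: nbhs_singleton (graph_chart_near0 ci) ix.
exists J, phi; split=> //.
  apply: filterS chart_near => x cx i ix v; have [_ ci] := cx i ix.
  split=> [/tangent_vectorP[k [g [c']]]|v0].
    exact: chart_independence (Gam_hyp i) ix c' ci.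
  by apply/tangent_vectorP; exists (kg i).1, (kg i).2.
have : \forall x \near x0,
    (forall i, Gam i x -> i \in J /\ graph_chart (Gam i) x (kg i).1 (kg i).2) /\
    (forall i, Gam i x -> i \in J /\ phi i x = 0).
  exact: filterI chart_near sub_near.
move=> /near_normP[r0 r00 near0].
have [F [G [rho [r [/andP[rho0 rho_r0] rpos [FJ F0 Fid] Gu Fxy]]]]] :=
  straightening phi0 phi_smooth free r00.
have inr0 x : `|x - x0| < rho -> `|x - x0| < r0 by move=> /lt_le_trans; exact.
have GF x : `|x - x0| < rho -> `|F x - x0| < r -> G (F x) = x.
  move=> xrho /Gu[Grho FG]; apply/eqP; rewrite -subr_eq0 -normr_le0.
  apply: le_trans (Fxy _ _ Grho xrho) _.
  by rewrite FG subrr normr0 mulr0.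
have GL u v : `|u - x0| < r -> `|v - x0| < r -> `|G u - G v| <= 2 * `|u - v|.
  move=> /Gu[ur FGu] /Gu[vr FGv].
  by apply: le_trans (Fxy _ _ ur vr) _; rewrite FGu FGv.
have good_near : \forall x \near x0, `|x - x0| < rho /\ `|F x - x0| < r.
  have [r1 r10 Fr] := Fid 1 ltr01.
  have m0 : 0 < Num.min rho (Num.min r1 (r / 2)).
    by rewrite !lt_min rho0 r10 divr_gt0.
  apply/near_normP; exists (Num.min rho (Num.min r1 (r / 2))) => //.
  move=> x; rewrite !lt_min => /andP[xrho /andP[x1 xr]]; split=> //.
  have := Fr x x0 x1; rewrite subrr normr0 F0 mul1r => /(_ r10) H.
  rewrite -[F x - x0](subrK (x - x0)) (splitr r).
  by apply: le_lt_trans (ler_normD _ _) _; rewrite ltrD // (le_lt_trans H).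
have convex_r (u v : 'rV[R]_d.+1) (t : R) :
    0 <= t <= 1 -> `|u - x0| < r -> `|v - x0| < r ->
    `|u + t *: (v - u) - x0| < r.
  move=> /andP[t0 t1] ur vr.
  have -> : u + t *: (v - u) - x0 = (1 - t) *: (u - x0) + t *: (v - x0).
    by apply/rowP => i; rewrite !mxE; ring.
  apply: le_lt_trans (ler_normD _ _) _; rewrite !normrZ ger0_norm ?subr_ge0 //.
  rewrite (ger0_norm t0); have [->|tn0] := eqVneq t 0.
    by rewrite subr0 mul1r mul0r addr0.
  have -> : r = (1 - t) * r + t * r by ring.
  rewrite ler_ltD // ?ler_wpM2l ?subr_ge0 // 1?ltW //.
  by rewrite ltr_pM2l // lt_def tn0.
apply: (filterS _ good_near) => x [xrho xr] x_zero i iJ.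
have Six0 : Gam i x0 by apply/JP.
have [clGi _ /(_ _ Six0) clint] := Gam_hyp i.
have [z [zint [zrho zr]]] := clint _ good_near.
have Sz : Gam i z by case: zint.
have [/(_ _ Sz)[_ cz] /(_ _ Sz)[_ phiz]] := near0 _ (inr0 _ zrho).
have [w wP] := dual_basis free.
(* Adding a small multiple of W to F z stays in the chart of the piece i but
   leaves all the other charts. *)
pose W := \sum_(k in J :\ i) w k.
have Wi : dot (grad (phi i) x0) W = 0.
  rewrite dot_sumr big1 // => k; rewrite finset.in_setD1 => /andP[ki kJ].
  by rewrite wP // eq_sym (negPf ki).
have Wk k : k \in J -> k != i -> dot (grad (phi k) x0) W = 1.
  move=> kJ ki; rewrite dot_sumr (bigD1 k) ?finset.in_setD1 ?ki //=.
  rewrite wP // eqxx big1 ?addr0 // => l /andP[]; rewrite finset.in_setD1.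
  by move=> /andP[_ lJ] lk; rewrite wP // eq_sym (negPf lk).
pose u0 (t : R) := F z + t *: W.
have W1 : 0 < `|W| + 1 by rewrite ltr_wpDl.
have near_u0 (e : R) : 0 < e -> \forall t \near (0 : R)^'+, `|u0 t - F z| < e.
  move=> e0; near=> t; rewrite /u0 addrC addKr normrZ.
  have t0 : 0 < t by near: t; exact: nbhs_right_gt.
  have te : t < e / (`|W| + 1) by near: t; apply: nbhs_right_lt; rewrite divr_gt0.
  rewrite gtr0_norm //; apply: le_lt_trans (_ : t * (`|W| + 1) < e).
    by rewrite ler_wpM2l ?lerDl // ltW.
  by rewrite -ltr_pdivlMr.
have near_u0r : \forall t \near (0 : R)^'+, `|u0 t - x0| < r.
  have e0 : 0 < r - `|F z - x0| by rewrite subr_gt0.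
  apply: filterS (near_u0 _ e0) => t; rewrite ltrBrDr; apply: le_lt_trans.
  by rewrite -{1}[u0 t](subrK (F z)) -addrA; exact: ler_normD.
have near_S : \forall t \near (0 : R)^'+, Gam i (G (u0 t)).
  have /near_normP[e e0 eS] := interior_point_graph cz zint.
  have e20 : 0 < e / 2 by rewrite divr_gt0.
  apply: filterS2 near_u0r (near_u0 _ e20) => t tr te; apply: eS.
    rewrite -{1}(GF z) //; apply: le_lt_trans (GL _ _ tr zr) _.
    by rewrite mulrC -ltr_pdivlMr.
  rewrite -/(phi i _) -FJ // (Gu _ tr).2 /u0 addrAC dotDr FJ // phiz.
  by rewrite dotZr Wi mulr0 addr0.
have near_nz : \forall t \near (0 : R)^'+, forall k, k \in J -> k != i ->
    phi k z + t != 0.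
  suff H (k : 'I_s) : \forall t \near (0 : R)^'+, k \in J -> k != i ->
      phi k z + t != 0 by exact: filter_forall H.
  have [z0|z0] := leP 0 (phi k z).
    near=> t; move=> _ _; rewrite gt_eqF // ltr_wpDl //.
  near=> t; move=> _ _; rewrite lt_eqF // addrC -ltrBrDr sub0r.
  by near: t; apply: nbhs_right_lt; rewrite oppr_gt0.
have [t [[tr tS] tnz]] : exists t,
    (`|u0 t - x0| < r /\ Gam i (G (u0 t))) /\
    forall k, k \in J -> k != i -> phi k z + t != 0.
  apply: (@filter_ex _ ((0 : R)^'+)).
  exact: filterI (filterI near_u0r near_S) near_nz.
(* The segment from u0 t to F x lies in the hyperplane of the chart i, and
   before its end it meets none of the hyperplanes of the other charts. *)
pose u (q : R) := u0 t + q *: (F x - u0 t).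
have ur q : 0 <= q <= 1 -> `|u q - x0| < r by move=> q01; exact: convex_r.
have uphi q k : 0 <= q <= 1 -> k \in J ->
    phi k (G (u q)) = (1 - q) * dot (grad (phi k) x0) (u0 t - x0).
  move=> q01 kJ; rewrite -FJ // (Gu _ (ur _ q01)).2.
  have -> : u q - x0 = (1 - q) *: (u0 t - x0) + q *: (F x - x0).
    by apply/rowP => l; rewrite !mxE; ring.
  rewrite [LHS]dotDr ![in LHS]dotZr (FJ x) // x_zero //.
  by rewrite mulr0 addr0.
have uphi_i q : 0 <= q <= 1 -> phi i (G (u q)) = 0.
  move=> q01; rewrite uphi // /u0 addrAC dotDr FJ // phiz dotZr Wi.
  by rewrite mulr0 addr0 mulr0.
have u1 : u 1 = F x by rewrite /u scale1r addrC subrK.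
rewrite -(GF x) // -u1.
apply: (@segment_invariant R _ (fun q => G (u q)) (Gam i)
  (fun y => phi i y = 0) (2 * `|F x - u0 t|)) => //.
- by rewrite /u scale0r addr0.
- move=> q p q01 p01; apply: le_trans (GL _ _ (ur _ q01) (ur _ p01)) _.
  have -> : u q - u p = (q - p) *: (F x - u0 t).
    by apply/rowP => l; rewrite !mxE; ring.
  by rewrite normrZ -mulrA ler_wpM2l // mulrC.
move=> q /andP[q0 q1] Sq.
have q01 : 0 <= q <= 1 by rewrite q0 ltW.
have [Grho _] := Gu _ (ur _ q01).
have [nearq nearq0] := near0 _ (inr0 _ Grho).
have [_ cq] := nearq _ Sq.
apply: interior_point_graph cq _; apply: contrapT => /(Gam_edges Sq)[k ki kq].
have [kJ kphi] := nearq0 _ kq.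
move: kphi; rewrite uphi // => /eqP; rewrite mulf_eq0 subr_eq0 gt_eqF //=.
rewrite /u0 addrAC dotDr FJ // dotZr Wk // mulr1.
by rewrite (negPf (tnz k kJ ki)).
Unshelve. all: by end_near. Qed.

End local_frames.

(** * Contact of hyperplanes *)

Section last_coordinate.
Context {R : realType} {d : nat}.
Implicit Types (x y : 'rV[R]_d.+1) (b u : 'rV[R]_d).

Definition append_coord u (t : R) : 'rV[R]_d.+1 :=
  \row_i oapp (fun j => u 0 j) t (unlift ord_max i).

Lemma append_coord_last u t : append_coord u t 0 ord_max = t.
Proof. by rewrite mxE unlift_none. Qed.

Lemma col'_append_coord u t : col' ord_max (append_coord u t) = u.
Proof. by apply/rowP => j; rewrite !mxE liftK. Qed.

Lemma row_appendP x y : col' ord_max x = col' ord_max y ->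
  x 0 ord_max = y 0 ord_max -> x = y.
Proof.
move=> xy' xyn; apply/rowP => i.
have [j ->|->] := unliftP ord_max i; last exact: xyn.
by have /rowP/(_ j) := xy'; rewrite !mxE.
Qed.

Lemma dot_last x y :
  dot x y = x 0 ord_max * y 0 ord_max + dot (col' ord_max x) (col' ord_max y).
Proof.
rewrite /dot (bigD1_ord ord_max) //=; congr (_ + _).
by apply: eq_bigr => i _; rewrite !mxE.
Qed.

(** The normal of the hyperplanes x_n = b.x' - q. *)
Definition conormal b : 'rV[R]_d.+1 := append_coord (- b) 1.

Lemma dot_conormal b x :
  dot (conormal b) x = x 0 ord_max - dot b (col' ord_max x).
Proof. by rewrite dot_last append_coord_last col'_append_coord mul1r dotNl. Qed.

Lemma conormal_last b : conormal b 0 ord_max = 1.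
Proof. exact: append_coord_last. Qed.

Lemma conormalE x : x 0 ord_max != 0 ->
  x = x 0 ord_max *: conormal (- (x 0 ord_max)^-1 *: col' ord_max x).
Proof.
move=> xn; apply: row_appendP; last by rewrite [RHS]mxE conormal_last mulr1.
apply/rowP => j; have /rowP/(_ j) := col'_append_coord
  (- (- (x 0 ord_max)^-1 *: col' ord_max x)) 1.
rewrite mxE => E; rewrite [RHS]mxE [RHS]mxE E !mxE mulNr opprK mulrA.
by rewrite mulfV // mul1r.
Qed.

End last_coordinate.

Section contacts.
Context {R : realType} {d s : nat} (Gam : 'I_s -> set 'rV[R]_d.+1).

(** The hyperplane is the one of slope b through x; its level is height x b. *)
Definition contact (x : 'rV[R]_d.+1) (b : 'rV[R]_d) := exists I : {set 'I_s},
  [/\ I != finset.set0, common_points Gam I x &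
      forall v, common_tangent Gam I x v -> dot (conormal b) v = 0].

Definition height (x : 'rV[R]_d.+1) (b : 'rV[R]_d) : R :=
  dot b (col' ord_max x) - x 0 ord_max.

Lemma common_tangentZ I x v (c : R) :
  common_tangent Gam I x v -> common_tangent Gam I x (c *: v).
Proof.
move=> vI i /vI /tangent_vectorP[k [g [cg g0]]]; apply/tangent_vectorP.
by exists k, g; split=> //; rewrite dotZr g0 mulr0.
Qed.

(** A common tangent vector outside the hyperplane spans a complement of the
    direction of the hyperplane. *)
Lemma transversal_atPn al I x : al != 0 ->
  ~ transversal_at Gam al I x <->
  forall v, common_tangent Gam I x v -> dot al v = 0.
Proof.
move=> al0; split=> [tr v vI|alI tr].
  apply/eqP; apply: contrapT => /negP alv; apply: tr => w.
  pose c := dot al w / dot al v.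
  exists (w - c *: v), (c *: v); split; last by rewrite subrK.
    by rewrite dotBr dotZr /c divfK // subrr.
  exact: common_tangentZ.
have [u [v [u0 /alI v0 E]]] := tr al.
have : dot al al = 0 by rewrite {2}E dotDr u0 v0 addr0.
by move/dot_eq0/eqP; rewrite (negPf al0).
Qed.

Lemma Qset_affineP b q :
  Qset_affine Gam (b, q) <-> exists2 x, contact x b & q = height x b.
Proof.
split=> [[al [p [[/= al0 [I [x [I0 xI xp ntr]]]] aln bE qE]]]|].
  have alE := conormalE aln; rewrite -bE in alE.
  exists x.
    exists I; split=> // v vI; have := (transversal_atPn I x al0).1 ntr v vI.
    rewrite alE dotZl => /eqP; rewrite mulf_eq0 => /orP[|/eqP //].
    by rewrite (negPf aln).
  move: xp; rewrite /hyperplane /= {1}alE dotZl dot_conormal -/(height x b).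
  move/eqP; rewrite subr_eq0 => /eqP pE.
  by rewrite qE -pE /height mulNr mulrAC mulfV // mul1r opprB.
move=> [x [I [I0 xI ctI]] ->].
have cn0 : conormal b != 0.
  apply/eqP => c0; have := conormal_last b; rewrite c0 mxE => /eqP.
  by rewrite eq_sym oner_eq0.
exists (conormal b), (- height x b); rewrite /= conormal_last.
split=> //.
- split=> //=; exists I, x; split=> //.
    by rewrite /hyperplane /= dot_conormal /height; ring.
  exact/transversal_atPn.
- by rewrite invr1 scaleN1r col'_append_coord opprK.
- by rewrite opprK divr1.
Qed.

Variables (x0 : 'rV[R]_d.+1) (J : {set 'I_s}).
Variable phi : 'I_s -> 'rV[R]_d.+1 -> R.
Hypothesis frame : local_frame Gam x0 J phi.

Lemma contact_span : \forall x \near x0, forall b, contact x b ->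
  exists a : 'I_s -> R, conormal b = \sum_(j in J) a j *: grad (phi j) x.
Proof.
apply: filterS2 (frame_sub frame) (frame_tangent frame) => x xsub xtan b.
move=> [I [_ xI bI]].
have [v vI|a aE a0] := @span_of_kernel _ _ _ (fun j => grad (phi j) x) I
    (conormal b).
  by apply: bI => i iI; apply/(xtan i (xI i iI)); exact: vI.
exists a; rewrite aE big_mkcond [RHS]big_mkcond; apply: eq_bigr => i _.
case: ifP => [iI|/negbT iI].
  by have [-> _] := xsub i (xI i iI).
by rewrite a0 // scale0r; case: ifP.
Qed.

Lemma span_contact : \forall x \near x0, (forall j, j \in J -> phi j x = 0) ->
  forall b (a : 'I_s -> R), conormal b = \sum_(j in J) a j *: grad (phi j) x ->
  contact x b.
Proof.
apply: filterS2 (frame_common frame) (frame_tangent frame) => x xJ xtan x0J b a.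
move=> bE; exists J; split.
- apply/eqP => J0; have := conormal_last b; rewrite bE J0 finset.big_set0 mxE.
  by move/eqP; rewrite eq_sym oner_eq0.
- by move=> j jJ; exact: xJ.
- move=> v vJ; rewrite bE dot_suml big1 // => j jJ; rewrite dotZl.
  by rewrite ((xtan j (xJ x0J j jJ) v).1 (vJ j jJ)) mulr0.
Qed.

(** The coefficients of conormal b in the normals at x remain bounded, because
    those normals stay close to independent ones. *)
Lemma contact_closed b0 : closure [set xb | contact xb.1 xb.2] (x0, b0) ->
  exists a : 'I_s -> R, conormal b0 = \sum_(j in J) a j *: grad (phi j) x0.
Proof.
move=> clos; suff H v : (forall j, j \in J -> dot (grad (phi j) x0) v = 0) ->
    dot (conormal b0) v = 0.
  by have [a aE _] := span_of_kernel H; exists a.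
move=> vJ; apply/eqP; rewrite -normr_le0 leNgt; apply/negP => D0.
set D := `|_| in D0.
have [w wP] := dual_basis (frame_free frame).
have near_dot (u : 'rV[R]_d.+1) (e : R) : 0 < e -> \forall x \near x0,
    forall j, j \in J -> `|dot (grad (phi j) x) u - dot (grad (phi j) x0) u| < e.
  move=> e0; suff near_j (j : 'I_s) : \forall x \near x0, j \in J ->
      `|dot (grad (phi j) x) u - dot (grad (phi j) x0) u| < e.
    exact: filter_forall near_j.
  have [jJ|jJ] := pselect (j \in J); last first.
    by apply: (@filterE _ (nbhs x0)) => x /jJ.
  have cj : {for x0, continuous (fun x => dot (grad (phi j) x) u)}.
    apply: dot_continuous => i; last exact: cst_continuous.
    rewrite grad_coordE.
    exact: smooth_near_partial_continuous (frame_smooth frame jJ).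
  by apply: filterS ((continuous_normP _ _).1 cj e e0) => x xe _.
have near_con (u : 'rV[R]_d.+1) (e : R) : 0 < e -> \forall b \near b0,
    `|dot (conormal b) u - dot (conormal b0) u| < e.
  move=> e0; apply: (continuous_normP _ _).1 => //.
  rewrite (_ : (fun _ => _) =
      fun b => u 0 ord_max - dot b (col' ord_max u)); last first.
    by apply: funext => b; exact: dot_conormal.
  apply: continuousB; first exact: cst_continuous.
  by apply: dot_continuous => i; [exact: coord_continuous|exact: cst_continuous].
pose N : R := s.+1%:R; have N0 : 0 < N by rewrite ltr0n.
pose C : R := \sum_(j in J) (`|dot (conormal b0) (w j)| + 1).
have C0 : 0 <= C by apply: sumr_ge0 => j _; rewrite addr_ge0.
pose eta := D / 2 / (2 * C + 1).
have C1 : 0 < 2 * C + 1 by rewrite ltr_wpDl // mulr_ge0.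
have eta0 : 0 < eta by rewrite !divr_gt0.
have near_x : \forall x \near x0,
    [/\ forall b, contact x b ->
          exists a : 'I_s -> R, conormal b = \sum_(j in J) a j *: grad (phi j) x,
        forall j, j \in J ->
          `|dot (grad (phi j) x) v - dot (grad (phi j) x0) v| < eta &
        forall k j, j \in J ->
          `|dot (grad (phi j) x) (w k) - dot (grad (phi j) x0) (w k)| < (2 * N)^-1].
  have near_w (k : 'I_s) := near_dot (w k) (2 * N)^-1
    ltac:(by rewrite invr_gt0 mulr_gt0).
  have near_ws := filter_forall (@nbhs_filter _ x0) near_w.
  by apply: filterS3 contact_span (near_dot v eta eta0) near_ws => x *; split.
have near_b : \forall b \near b0,
    `|dot (conormal b) v - dot (conormal b0) v| < D / 2 /\
    forall k, `|dot (conormal b) (w k) - dot (conormal b0) (w k)| < 1.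
  have D2 : 0 < D / 2 by rewrite divr_gt0.
  have near_ws := filter_forall (@nbhs_filter _ b0)
    (fun k : 'I_s => near_con (w k) 1 ltr01).
  by apply: filterS2 (near_con v _ D2) near_ws => b *; split.
have [[x b] [/= xb [[Hspan Hv Hw] [bv bw]]]] :=
  clos _ (near_setX near_x near_b).
have [a aE] := Hspan b xb.
pose A := \sum_(j in J) `|a j|.
have A0 : 0 <= A by exact: sumr_ge0.
have aj j : j \in J -> `|a j| <= `|dot (conormal b0) (w j)| + 1 + A / (2 * N).
  move=> jJ; have -> : a j = dot (conormal b) (w j) -
      \sum_(i in J) a i * (dot (grad (phi i) x) (w j) - (i == j)%:R).
    rewrite aE dot_suml (eq_bigr (fun i => a i * dot (grad (phi i) x) (w j)));
      last by move=> i _; rewrite dotZl.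
    rewrite -sumrB (bigD1 j) //= big1 => [|i /andP[iJ ij]].
      by rewrite eqxx addr0 mulrBr mulr1 subKr.
    by rewrite (negPf ij) subr0 subrr.
  apply: le_trans (ler_normB _ _) _; apply: lerD.
    rewrite -[dot (conormal b) _](subrK (dot (conormal b0) (w j))) addrC.
    by apply: le_trans (ler_normD _ _) _; rewrite lerD2l ltW.
  apply: le_trans (ler_norm_sum _ _ _) _; rewrite mulr_suml.
  apply: ler_sum => i iJ; rewrite normrM ler_wpM2l //.
  by rewrite -(wP i j iJ jJ) ltW // Hw.
(* The entries of the Gram matrix are within 1 / 2N of those of the identity,
   and there are fewer than N coefficients. *)
have AC : A <= 2 * C.
  have : A <= C + A / 2.
    apply: le_trans (ler_sum _ aj) _; rewrite big_split /= -/C lerD2l.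
    rewrite sumr_const -[_ *+ #|_|]mulr_natr.
    set m := (#|_|)%:R.
    have mN : m <= N.
      rewrite ler_nat; apply: leq_trans (leqnSn s).
      by rewrite -[X in (_ <= X)%N]card_ord max_card.
    have -> : A / 2 = A / (2 * N) * N by field; rewrite lt0r_neq0.
    by rewrite ler_wpM2l // divr_ge0 // mulr_ge0.
  by move=> H; lra.
have : D < D; last by rewrite ltxx.
have {1}-> : D = `|dot (conormal b) v - (dot (conormal b) v - dot (conormal b0) v)|.
  by rewrite subKr.
rewrite [ltRHS]splitr; apply: le_lt_trans (ler_normB _ _) _.
rewrite ler_ltD //.
apply: le_trans (_ : eta * A <= _).
  rewrite aE dot_suml mulr_sumr; apply: le_trans (ler_norm_sum _ _ _) _.
  apply: ler_sum => j jJ; rewrite dotZl normrM mulrC ler_wpM2r //.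
  by have := Hv j jJ; rewrite vJ // subr0 => /ltW.
rewrite /eta mulrAC ler_pdivrMr // ler_wpM2l ?divr_ge0 // ?ltW //.
by rewrite (le_lt_trans AC) // ltrDl.
Qed.

End contacts.

(** * The radial field of the contact set *)

Lemma is_derive_dot (R : realType) (V : normedModType R) n
    (p q : V -> 'rV[R]_n) (a v : V) (dp dq : 'rV[R]_n) :
  (forall i, is_derive a v (fun s => p s 0 i) (dp 0 i)) ->
  (forall i, is_derive a v (fun s => q s 0 i) (dq 0 i)) ->
  is_derive a v (fun s => dot (p s) (q s)) (dot dp (q a) + dot (p a) dq).
Proof.
move=> pd qd; rewrite /dot -big_split /=.
by apply: is_derive_sumf => i _; exact: is_derive_mulf.
Qed.

Lemma curve_near (R : realType) n (c : R -> 'rV[R]_n) (a v : 'rV[R]_n)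
    (P : set 'rV[R]_n) :
  c 0 = a -> (forall i, is_derive (0 : R) 1 (fun t => c t 0 i) (v 0 i)) ->
  (\forall x \near a, P x) -> \forall t \near (0 : R), P (c t).
Proof.
move=> <- dc aP; have cc : {for 0, continuous c}; last exact: cc _ aP.
apply: row_continuous => i; apply: differentiable_continuous.
by apply/derivable1_diffP; have [] := dc i.
Qed.

Lemma is_derive_near (R : realType) (F : R -> R) (l : R) (P : set R) :
  is_derive (0 : R) 1 F l -> (\forall y \near F 0, P y) ->
  \forall t \near (0 : R), P (F t).
Proof.
move=> [dF _] FP; have Fc : {for 0, continuous F}; last exact: Fc _ FP.
by apply: differentiable_continuous; exact/derivable1_diffP.
Qed.

Lemma is_derive_unique_near0 (R : realType) (F : R -> R) (l : R) :
  is_derive (0 : R) 1 F l -> (\forall t \near (0 : R), F t = 0) -> l = 0.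
Proof.
move=> [_ <-] F0; have F0' : \forall t \near (0 : R), (cst 0 : R -> R) t = F t.
  by apply: filterS F0 => t ->.
have [_ ->//] := near_eq_is_derive F0' (is_derive_cst (0 : R) (0 : R) (1 : R)).
Qed.

Lemma local_max_derive_le0 (R : realType) (F : R -> R) (l : R) :
  is_derive (0 : R) 1 F l -> (\forall t \near (0 : R), F t <= F 0) -> l <= 0.
Proof.
move=> /(@is_derive_approxP _ R^o) dF Fmax; rewrite leNgt; apply/negP => l0.
have l2 : 0 < l / 2 by rewrite divr_gt0.
have /(@near_normP R R^o)[r r0 rP] : \forall t \near (0 : R),
    `|F (0 + t *: (1 : R^o)) - F 0 - t * l| <= l / 2 * `|t| /\ F t <= F 0.
  by apply: filterI Fmax; exact: dF.
have r2 : 0 < r / 2 by rewrite divr_gt0.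
have [] := rP (r / 2).
  by rewrite subr0 gtr0_norm // ltr_pdivrMr // ltr_pMr // ltr1n.
have -> : 0 + r / 2 *: (1 : R^o) = r / 2 by rewrite add0r /GRing.scale /= mulr1.
rewrite (gtr0_norm r2) => H1 H2.
have := ler_normlW H1; have := lerNnormlW H1.
have : 0 < l / 2 * (r / 2) by rewrite mulr_gt0.
have -> : l / 2 * (r / 2) = l * r / 4 by field.
have -> : r / 2 * l = l * r / 2 by field.
lra.
Qed.

Definition hess_apply (R : realType) n (f : 'rV[R]_n -> R)
    (x v : 'rV[R]_n) : 'rV[R]_n := \row_i dot (grad (partial i f) x) v.

Lemma hess_applyC (R : realType) n (f : 'rV[R]_n -> R) (x u v : 'rV[R]_n) :
  smooth_near x f -> dot (hess_apply f x v) u = dot (hess_apply f x u) v.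
Proof.
move=> [U [oU Ux] fC]; rewrite /dot.
under eq_bigr => i _ do rewrite mxE mulr_suml.
under [RHS]eq_bigr => i _ do rewrite mxE mulr_suml.
rewrite exchange_big /=; apply: eq_bigr => i _; apply: eq_bigr => j _.
have gradE k l : grad (partial k f) x 0 l = partial l (partial k f) x.
  by rewrite mxE.
have E : grad (partial j f) x 0 i = grad (partial i f) x 0 j.
  apply: etrans (gradE j i) _; apply: etrans _ (esym (gradE i j)).
  exact: partialC oU Ux (fC 2%N).
exact: etrans (mulrAC _ _ _) (congr1 (fun z => z * u 0 j * v 0 i) E).
Qed.

Lemma hess_apply0 (R : realType) n (f : 'rV[R]_n -> R) (x : 'rV[R]_n) :
  hess_apply f x 0 = 0.
Proof. by apply/rowP => i; rewrite !mxE dot0r. Qed.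

Section contact_curves.
Context {R : realType} {d s : nat} (Gam : 'I_s -> set 'rV[R]_d.+1).
Variables (x0 : 'rV[R]_d.+1) (J : {set 'I_s}).
Variable phi : 'I_s -> 'rV[R]_d.+1 -> R.
Hypothesis frame : local_frame Gam x0 J phi.
Variables (U : set 'rV[R]_d) (h : 'rV[R]_d -> R) (b0 : 'rV[R]_d).
Hypotheses (oU : open U) (Ub0 : U b0) (hC : class_C 2 U h).
Hypothesis hQ : \forall bq \near (b0, h b0),
  Qset_affine Gam bq <-> bq.2 = h bq.1.
Hypothesis height0 : height x0 b0 = h b0.
Variable a : 'I_s -> R.
Hypothesis a_span : conormal b0 = \sum_(j in J) a j *: grad (phi j) x0.

(** The velocity of the conormal covector when x0 moves with velocity v and
    the coefficients a with velocity c. *)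
Definition covelocity (v : 'rV[R]_d.+1) (c : 'I_s -> R) : 'rV[R]_d.+1 :=
  \sum_(j in J) (c j *: grad (phi j) x0 + a j *: hess_apply (phi j) x0 v).

(** The derivative of the slope - al' / al_n at a covector al with al_n = 1. *)
Definition slope_velocity v c : 'rV[R]_d :=
  - (col' ord_max (covelocity v c) + covelocity v c 0 ord_max *: b0).

Lemma is_derive_height (x : R -> 'rV[R]_d.+1) (b : R -> 'rV[R]_d)
    (v : 'rV[R]_d.+1) (w : 'rV[R]_d) :
  (forall i, is_derive (0 : R) 1 (fun t => x t 0 i) (v 0 i)) ->
  (forall i, is_derive (0 : R) 1 (fun t => b t 0 i) (w 0 i)) ->
  is_derive (0 : R) 1 (fun t => height (x t) (b t))
    (dot w (col' ord_max (x 0)) - dot (conormal (b 0)) v).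
Proof.
move=> dx db; rewrite dot_conormal.
have -> : dot w (col' ord_max (x 0)) -
    (v 0 ord_max - dot (b 0) (col' ord_max v)) =
    dot w (col' ord_max (x 0)) + dot (b 0) (col' ord_max v) - v 0 ord_max.
  by rewrite opprB addrA.
apply: (is_derive_subf _ (dx ord_max)).
apply: (@is_derive_dot _ R^o) => // i; rewrite (_ : (fun _ => _) =
  (fun t => x t 0 (lift ord_max i))); first by rewrite mxE.
by apply: funext => t; rewrite mxE.
Qed.

(** Combinations of the normals along a curve in the stratum are conormals of
    contacts, and then the equation of Q_f determines the height. *)
Lemma contact_curve v c :
  (forall j, j \in J -> dot (grad (phi j) x0) v = 0) ->
  exists (x : R -> 'rV[R]_d.+1) (b : R -> 'rV[R]_d),
  [/\ x 0 = x0, b 0 = b0,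
      forall i, is_derive (0 : R) 1 (fun t => x t 0 i) (v 0 i),
      forall i, is_derive (0 : R) 1 (fun t => b t 0 i) (slope_velocity v c 0 i) &
      \forall t \near (0 : R),
        contact Gam (x t) (b t) /\ height (x t) (b t) = h (b t)].
Proof.
move=> vJ.
have [x [xx0 dx xJ]] := zero_set_curve (frame_zero frame) (frame_smooth frame)
  (frame_free frame) vJ.
pose al (t : R) := \sum_(j in J) (a j + t * c j) *: grad (phi j) (x t).
have al0 : al 0 = conormal b0.
  by rewrite /al xx0 a_span; apply: eq_bigr => j _; rewrite mul0r addr0.
have dal i : is_derive (0 : R) 1 (fun t => al t 0 i) (covelocity v c 0 i).
  have -> : (fun t => al t 0 i) =
      (fun t => \sum_(j in J) (a j + t * c j) * partial i (phi j) (x t)).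
    apply: funext => t; rewrite summxE; apply: eq_bigr => j _.
    by rewrite [LHS]mxE; congr (_ * _); rewrite mxE.
  rewrite summxE; apply: is_derive_sumf => j jJ.
  have -> : (c j *: grad (phi j) x0 + a j *: hess_apply (phi j) x0 v) 0 i =
     c j * partial i (phi j) (x 0) +
     (a j + 0 * c j) * dot (grad (partial i (phi j)) (x 0)) v.
    by rewrite xx0 !mxE; ring.
  have dcoef : is_derive (0 : R) 1 (fun t => a j + t * c j) (c j).
    apply/(@is_derive_approxP _ R^o) => e e0; near=> t.
    rewrite [_ *: _]mulr1 (_ : _ - _ = 0) ?normr0 ?mulr_ge0 // ?ltW //.
    by ring.
  apply: (is_derive_mulf dcoef); apply: (@strict_diff_comp _ R^o) => //.
  have [W [oW Wx] fC] := frame_smooth frame jJ; rewrite xx0.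
  exact: class_C_strict_diff oW Wx (class_C_partial i (fC 2%N)).
pose b t := - (al t 0 ord_max)^-1 *: col' ord_max (al t).
have bb0 : b 0 = b0.
  by rewrite /b al0 conormal_last invr1 scaleN1r col'_append_coord opprK.
have db i : is_derive (0 : R) 1 (fun t => b t 0 i) (slope_velocity v c 0 i).
  have -> : (fun t => b t 0 i) =
      (fun t => - ((al t 0 ord_max)^-1 * al t 0 (lift ord_max i))).
    by apply: funext => t; rewrite !mxE mulNr.
  have -> : slope_velocity v c 0 i = - (
      - (covelocity v c 0 ord_max * (al 0 0 ord_max)^-1 * (al 0 0 ord_max)^-1) *
        al 0 0 (lift ord_max i) +
      (al 0 0 ord_max)^-1 * covelocity v c 0 (lift ord_max i)).
    have bE : al 0 0 (lift ord_max i) = - b0 0 i.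
      by rewrite al0 mxE liftK /= mxE.
    by rewrite bE al0 conormal_last invr1 !mxE; ring.
  apply: is_derive_oppf; apply: is_derive_mulf => //.
  by apply: is_derive_invf; rewrite // al0 conormal_last oner_neq0.
have aln : \forall t \near (0 : R), al t 0 ord_max != 0.
  apply: (@is_derive_near _ _ _ [set r | r != 0] (dal ord_max)).
  apply: open_nbhs_nbhs; split; first exact: open_neq.
  by rewrite /= al0 conormal_last oner_neq0.
have ct : \forall t \near (0 : R), contact Gam (x t) (b t).
  have := curve_near xx0 dx (span_contact frame).
  apply: filterS3 xJ aln => t xtJ altn /(_ xtJ); apply.
  instantiate (1 := fun j => (al t 0 ord_max)^-1 * (a j + t * c j)).
  transitivity ((al t 0 ord_max)^-1 *: al t).
    apply: (scalerI altn); rewrite scalerA mulfV // scale1r.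
    exact: esym (conormalE altn).
  by rewrite scaler_sumr; apply: eq_bigr => j _; rewrite scalerA.
exists x, b; split=> //.
have [[A B] [/= Ab0 Bq0] AB] := hQ.
have nearA := curve_near bb0 db Ab0.
have dh := is_derive_height dx db.
have nearB : \forall t \near (0 : R), B (height (x t) (b t)).
  by apply: is_derive_near dh _; rewrite xx0 bb0 height0.
apply: filterS3 ct nearA nearB => t ctt At Bt; split=> //.
apply: (AB (b t, height (x t) (b t)) _).1; first by split.
by apply/Qset_affineP; exists (x t).
Unshelve. all: by end_near. Qed.

Let y' := col' ord_max x0 - grad h b0.

(** Differentiate height = h: moving x inside its hyperplane does not change the
    height to first order, so only the motion of the slope counts. *)
Lemma slope_velocity_orthogonal v c :
  (forall j, j \in J -> dot (grad (phi j) x0) v = 0) ->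
  dot (slope_velocity v c) y' = 0.
Proof.
move=> vJ; have [x [b [xx0 bb0 dx db ct]]] := contact_curve c vJ.
have dhb : is_derive (0 : R) 1 (fun t => h (b t))
    (dot (grad h b0) (slope_velocity v c)).
  apply: (@strict_diff_comp _ R^o) => //; rewrite bb0.
  exact: class_C_strict_diff oU Ub0 (class_CW hC).
have := is_derive_unique_near0 (is_derive_subf (is_derive_height dx db) dhb) _.
rewrite xx0 bb0 a_span dot_suml big1 => [|j jJ]; last first.
  by rewrite dotZl vJ // mulr0.
rewrite subr0 [dot (grad h b0) _]dotC -dotBr; apply.
by apply: filterS ct => t [_ ->]; rewrite subrr.
Qed.

(* The lift of y' to a direction of the hyperplane of slope b0. *)
Let y := append_coord y' (dot b0 y').

Lemma covelocity_orthogonal v c :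
  (forall j, j \in J -> dot (grad (phi j) x0) v = 0) ->
  dot (covelocity v c) y = 0.
Proof.
move=> vJ; have := slope_velocity_orthogonal c vJ.
rewrite dotNl dotDl dotZl dot_last append_coord_last col'_append_coord addrC => /eqP.
by rewrite oppr_eq0 => /eqP.
Qed.

(** The differential relation y.d(al) = 0 shows first that y is tangent to
    the stratum, then, as the second derivatives are symmetric, that moving x0
    along y can be compensated by a change of coefficients. *)
Lemma radial_curve :
  exists (x : R -> 'rV[R]_d.+1) (b : R -> 'rV[R]_d),
  [/\ x 0 = x0, b 0 = b0,
      forall i, is_derive (0 : R) 1 (fun t => x t 0 i) (y 0 i),
      forall i, is_derive (0 : R) 1 (fun t => b t 0 i) 0 &
      \forall t \near (0 : R),
        contact Gam (x t) (b t) /\ height (x t) (b t) = h (b t)].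
Proof.
have yJ j : j \in J -> dot (grad (phi j) x0) y = 0.
  move=> jJ; have := @covelocity_orthogonal 0 (fun i => (i == j)%:R)
    (fun _ _ => dot0r _).
  rewrite /covelocity (bigD1 j) //= eqxx scale1r hess_apply0 scaler0 addr0.
  rewrite big1 ?addr0 // => i /andP[_ /negPf ->].
  by rewrite hess_apply0 scaler0 scale0r addr0.
have AyT v : (forall j, j \in J -> dot (grad (phi j) x0) v = 0) ->
    dot (\sum_(j in J) a j *: hess_apply (phi j) x0 y) v = 0.
  move=> vJ; have := @covelocity_orthogonal v (fun=> 0) vJ.
  rewrite /covelocity !dot_suml => E; rewrite -[RHS]E.
  apply: eq_bigr => j jJ; rewrite scale0r add0r !dotZl.
  by congr (_ * _); exact: hess_applyC (frame_smooth frame jJ).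
have [c cE _] := span_of_kernel AyT.
have [x [b [xx0 bb0 dx db ct]]] := contact_curve (fun j => - c j) yJ.
exists x, b; split=> // i.
suff sv0 : slope_velocity y (fun j => - c j) 0 i = 0.
  by rewrite -[X in is_derive _ _ _ X]sv0; exact: db.
rewrite /slope_velocity (_ : covelocity _ _ = 0).
  by rewrite !mxE mul0r addr0 oppr0.
rewrite /covelocity big_split /= cE -big_split big1 //= => j _.
by rewrite scaleNr addNr.
Qed.

End contact_curves.

(** * The contact points are those of the graph of h *)

Lemma continuous_fst_comp (T T' W : topologicalType) (F : T -> W)
    (p : T * T') :
  {for p.1, continuous F} -> {for p, continuous (fun xy => F xy.1)}.
Proof.
move=> Fc A /Fc FA; exists (F @^-1` A, setT); last by case=> x y [].
by split=> //; exact: filterT.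
Qed.

Lemma continuous_snd_comp (T T' W : topologicalType) (F : T' -> W)
    (p : T * T') :
  {for p.2, continuous F} -> {for p, continuous (fun xy => F xy.2)}.
Proof.
move=> Fc A /Fc FA; exists (setT, F @^-1` A); last by case=> x y [].
by split=> //; exact: filterT.
Qed.

Section contact_points.
Context {R : realType} {d s : nat} (Gam : 'I_s -> set 'rV[R]_d.+1).
Variables (K : set 'rV[R]_d.+1) (U : set 'rV[R]_d) (h : 'rV[R]_d -> R).
Variable bbar : 'rV[R]_d.
Hypotheses (K_compact : compact K) (Gam_K : forall i, Gam i `<=` K).
Hypothesis frames : forall x, exists J phi, local_frame Gam x J phi.
Hypotheses (oU : open U) (Ub : U bbar) (hC : class_C 2 U h).
Hypothesis hQ : \forall bq \near (bbar, h bbar),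
  Qset_affine Gam bq <-> bq.2 = h bq.1.

Let gap (xb : 'rV[R]_d.+1 * 'rV[R]_d) := col' ord_max xb.1 - grad h xb.2.

(** On the compact closure of the set of contacts whose slope is in a ball, the
    squared gap times a cutoff has a maximum.  If it were positive, the radial
    curve through the maximum would keep the slope to first order and increase
    the gap. *)
Lemma contact_point : \forall b \near bbar, forall x,
  contact Gam x b -> height x b = h b -> col' ord_max x = grad h b.
Proof.
have hc : {for bbar, continuous h} by exact: class_C_continuous hC Ub.
have good : \forall b \near bbar, U b /\
    \forall bq \near (b, h b), Qset_affine Gam bq <-> bq.2 = h bq.1.
  apply: filterI; first exact: open_nbhs_nbhs.
  have /= [[A B] [/= Ab Bq] AB] := near_join hQ.
  by apply: filterS2 Ab (hc _ Bq) => b Abb Bhb; exact: (AB (b, h b)).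
have /near_normP[r r0 rP] := good.
pose r2 := r / 2; have r20 : 0 < r2 by rewrite divr_gt0.
have r2r : r2 < r by rewrite ltr_pdivrMr // ltr_pMr // ltr1n.
pose cut (b : 'rV[R]_d) := r2 ^+ 2 - dot (b - bbar) (b - bbar).
pose B := [set b : 'rV[R]_d | 0 <= cut b].
have Br b : B b -> `|b - bbar| <= r2.
  rewrite /B /cut /= subr_ge0 => H; rewrite -ler_sqr ?nnegrE ?(ltW r20) //.
  exact: le_trans (norm_sqr_le_dot _) H.
have goodB b : B b -> U b /\
    \forall bq \near (b, h b), Qset_affine Gam bq <-> bq.2 = h bq.1.
  by move=> /Br H; apply: rP; exact: le_lt_trans r2r.
have cut_continuous (b : 'rV[R]_d) : {for b, continuous cut}.
  apply: continuousB; first exact: cst_continuous.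
  have subi i : {for b, continuous (fun c : 'rV[R]_d => (c - bbar) 0 i)}.
    rewrite (_ : (fun _ => _) = (fun c : 'rV[R]_d => c 0 i - bbar 0 i)).
      by apply: continuousB; [exact: coord_continuous|exact: cst_continuous].
    by apply: funext => c; rewrite !mxE.
  exact: dot_continuous.
have cut_pos b : 0 < cut b -> \forall c \near b, 0 < cut c.
  move=> cb; have Ncb : nbhs (cut b) [set t | 0 < t].
    by apply: open_nbhs_nbhs; split; [exact: open_gt|].
  exact: cut_continuous Ncb.
have B_closed : closed B.
  by apply: (@closed_comp _ _ cut [set t | 0 <= t]);
    [move=> b _; exact: cut_continuous|exact: closed_ge].
have B_compact : compact B.
  apply: bounded_closed_compact => //; exists (`|bbar| + r2); split.
    exact: num_real.
  move=> M bM b /Br bB; apply: le_trans (ltW bM).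
  rewrite -[b](subrK bbar) addrC; apply: le_trans (ler_normD _ _) _.
  by rewrite lerD2l.
pose Z := [set xb : 'rV[R]_d.+1 * 'rV[R]_d |
  [/\ contact Gam xb.1 xb.2, B xb.2 & height xb.1 xb.2 = h xb.2]].
have KB_compact : compact (K `*` B) by exact: compact_setX.
have ZK : Z `<=` K `*` B.
  move=> [x b] [/= [I [I0 xI _]] bB _]; split=> //=.
  have /finset.set0Pn[i iI] := I0.
  exact: Gam_K (xI i iI).
have KB_closed : closed (K `*` B).
  by apply: compact_closed => //; exact: norm_hausdorff.
have CK : closure Z `<=` K `*` B.
  by move=> p /(closure_subset ZK); exact: KB_closed.
have C_compact : compact (closure Z).
  by apply: subclosed_compact KB_compact CK; exact: closed_closure.
have fst_continuous (p : 'rV[R]_d.+1 * 'rV[R]_d) i :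
    {for p, continuous (fun xb : 'rV[R]_d.+1 * 'rV[R]_d => xb.1 0 i)}.
  by apply: (continuous_fst_comp (F := fun x : 'rV[R]_d.+1 => x 0 i));
    exact: coord_continuous.
have snd_continuous (p : 'rV[R]_d.+1 * 'rV[R]_d) i :
    {for p, continuous (fun xb : 'rV[R]_d.+1 * 'rV[R]_d => xb.2 0 i)}.
  by apply: (continuous_snd_comp (F := fun x : 'rV[R]_d => x 0 i));
    exact: coord_continuous.
have col'E i : (fun xb : 'rV[R]_d.+1 * 'rV[R]_d => col' ord_max xb.1 0 i) =
    (fun xb : 'rV[R]_d.+1 * 'rV[R]_d => xb.1 0 (lift ord_max i)).
  by apply: funext => xb; rewrite mxE.
have C_height p : closure Z p -> height p.1 p.2 = h p.2.
  move=> Cp; have [_ /goodB[Up _]] := CK _ Cp.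
  apply/eqP; rewrite -subr_eq0; apply/eqP.
  apply: (continuous_closure_eq0 
    (f := fun xb : 'rV[R]_d.+1 * 'rV[R]_d => height xb.1 xb.2 - h xb.2) Cp).
    apply: continuousB.
      apply: continuousB => //; apply: dot_continuous => i //.
      by rewrite col'E.
    by apply: continuous_snd_comp; exact: class_C_continuous hC Up.
  by apply: (@filterE _ (nbhs p)) => xb [_ _ ->]; rewrite subrr.
pose Phi (xb : 'rV[R]_d.+1 * 'rV[R]_d) := cut xb.2 * dot (gap xb) (gap xb).
have gapE i : (fun xb => gap xb 0 i) =
    (fun xb : 'rV[R]_d.+1 * 'rV[R]_d => xb.1 0 (lift ord_max i) - partial i h xb.2).
  apply: funext => xb; rewrite [LHS]mxE; congr (_ + _); first by rewrite mxE.
  by rewrite [LHS]mxE; congr (- _); rewrite mxE.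
have Phi_continuous : {within closure Z, continuous Phi}.
  apply: continuous_in_subspaceT => p /set_mem Cp.
  have [_ /goodB[Up _]] := CK _ Cp.
  have gc i : {for p, continuous (fun xb : 'rV[R]_d.+1 * 'rV[R]_d => gap xb 0 i)}.
    rewrite gapE; apply: continuousB => //; apply: continuous_snd_comp.
    exact: class_C_continuous (class_C_partial i hC) Up.
  have cut2 : {for p, continuous (fun xb : 'rV[R]_d.+1 * 'rV[R]_d => cut xb.2)}.
    exact: continuous_snd_comp.
  have gap2 : {for p, continuous (fun xb => dot (gap xb) (gap xb))}.
    exact: dot_continuous.
  exact: (continuousM cut2 gap2).
have bbar_cut : 0 < cut bbar by rewrite /cut subrr dot0r subr0 exprn_gt0.
apply: filterS (cut_pos _ bbar_cut) => b1 b1_cut x1 x1_contact x1_height.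
apply/eqP; rewrite -subr_eq0; apply: contrapT => /negP gap1.
have Z1 : Z (x1, b1) by split=> //; rewrite /B /= ltW.
have Phi1 : 0 < Phi (x1, b1).
  rewrite mulr_gt0 // lt_def dot_ge0 andbT; apply: contra gap1 => /eqP.
  by move=> /dot_eq0 g0; apply/eqP.
have [|p /set_mem Cp Pmax] := compact_EVT_max _ C_compact Phi_continuous.
  by exists (x1, b1); exact: subset_closure.
have Phip : 0 < Phi p.
  by apply: lt_le_trans Phi1 (Pmax _ _); apply/mem_set/subset_closure.
have [_ pB] := CK _ Cp; have [Up hQp] := goodB _ pB.
have p_cut : 0 < cut p.2.
  by rewrite lt_def pB andbT; apply: contraTneq Phip => c0; rewrite /Phi c0 mul0r ltxx.
have p_gap : 0 < dot (gap p) (gap p) by rewrite -(pmulr_rgt0 _ p_cut).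
case: p Cp Pmax Phip pB Up hQp p_cut p_gap => x0 b0 /= Cp Pmax Phip pB Up hQp
  p_cut p_gap.
have [J [phi frame]] := frames x0.
have [a a_span] : exists a : 'I_s -> R,
    conormal b0 = \sum_(j in J) a j *: grad (phi j) x0.
  apply: (contact_closed frame); move: Cp; apply: closure_subset.
  by move=> xb [].
have [x [b [xx0 bb0 dx db ct]]] :=
  radial_curve frame oU Up hC hQp (C_height _ Cp) a_span.
pose F t := Phi (x t, b t).
have dY i : is_derive (0 : R) 1 (fun t => gap (x t, b t) 0 i) (gap (x0, b0) 0 i).
  have -> : (fun t => gap (x t, b t) 0 i) =
      (fun t => x t 0 (lift ord_max i) - partial i h (b t)).
    by apply: funext => t; have /(congr1 (@^~ (x t, b t))) := gapE i.
  have -> : gap (x0, b0) 0 i = append_coord (gap (x0, b0))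
      (dot b0 (gap (x0, b0))) 0 (lift ord_max i) -
      dot (grad (partial i h) b0) 0.
    by rewrite dot0r subr0 [RHS]mxE liftK.
  apply: (is_derive_subf (dx (lift ord_max i))).
  apply: (@strict_diff_comp _ R^o) => [|j]; last by rewrite mxE; exact: db.
  by rewrite bb0; exact: class_C_strict_diff oU Up (class_C_partial i hC).
have dcut : is_derive (0 : R) 1 (fun t => cut (b t)) 0.
  have dsub i : is_derive (0 : R) 1 (fun t => (b t - bbar) 0 i)
      ((0 : 'rV[R]_d) 0 i).
    have -> : (fun t => (b t - bbar) 0 i) = (fun t => b t 0 i - bbar 0 i).
      by apply: funext => t; rewrite !mxE.
    rewrite mxE -[X in is_derive _ _ _ X]subr0.
    by apply: is_derive_subf => //; exact: is_derive_cst.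
  have := is_derive_subf (is_derive_cst (r2 ^+ 2) (0 : R) (1 : R))
    (@is_derive_dot _ R^o _ _ _ _ _ _ _ dsub dsub).
  by rewrite dot0l dot0r addr0 subr0.
have dF := is_derive_mulf dcut (@is_derive_dot _ R^o _ _ _ _ _ _ _ dY dY).
have : \forall t \near (0 : R), F t <= F 0.
  have db0 i : is_derive (0 : R) 1 (fun t => b t 0 i) ((0 : 'rV[R]_d) 0 i).
    by rewrite mxE; exact: db.
  have := curve_near bb0 db0 (cut_pos _ p_cut).
  apply: filterS2 ct => t [ctt ht] bt; rewrite /F xx0 bb0.
  by apply: Pmax; apply/mem_set/subset_closure; split=> //; rewrite /B /= ltW.
move=> /(local_max_derive_le0 dF).
rewrite mul0r add0r bb0 xx0 leNgt => /negP; apply.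
by rewrite mulr_gt0 // addr_gt0.
Qed.

End contact_points.

(** * The Legendre transform of h *)

Lemma mulmx_bounded (R : realType) m n (M : 'M[R]_(m, n)) :
  exists2 C : R, 0 < C & forall v : 'rV[R]_m, `|v *m M| <= C * `|v|.
Proof.
pose C : R := \sum_i \sum_j `|M i j|.
have C0 : 0 <= C by apply: sumr_ge0 => i _; apply: sumr_ge0.
exists (C + 1) => [|v]; first by rewrite ltr_wpDl.
apply: norm_le_coord => [|j]; first by rewrite mulr_ge0 // addr_ge0.
rewrite mxE; apply: le_trans (ler_norm_sum _ _ _) _.
apply: le_trans (_ : \sum_i `|M i j| * `|v| <= _).
  by apply: ler_sum => i _; rewrite normrM mulrC ler_wpM2l // coord_le_norm.
rewrite -mulr_suml ler_wpM2r //; apply: ler_wpDr => //.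
apply: ler_sum => i _; rewrite (bigD1 j) //= lerDl.
exact: sumr_ge0.
Qed.

(** Followed by the inverse of the Hessian at b0, grad h becomes tangent to the
    identity. *)
Lemma gradient_local_inverse (R : realType) d (U : set 'rV[R]_d)
    (h : 'rV[R]_d -> R) (b0 : 'rV[R]_d) (r0 : R) :
  open U -> U b0 -> class_C 2 U h -> \det (hessian h b0) != 0 -> 0 < r0 ->
  exists (rho r : R) (B : 'rV[R]_d -> 'rV[R]_d),
  [/\ 0 < rho <= r0, 0 < r,
      B (grad h b0) = b0,
      forall x, `|x - grad h b0| < r ->
        [/\ `|B x - b0| < rho, grad h (B x) = x & {for x, continuous B}] &
      forall b b', `|b - b0| < rho -> `|b' - b0| < rho ->
        grad h b = grad h b' -> b = b'].
Proof.
move=> oU Ub hC hdet r00; pose H := (hessian h b0)^T.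
have Hu : H \in unitmx by rewrite unitmxE det_tr unitfE.
pose M := invmx H.
have [C C0 MC] := mulmx_bounded M.
pose F b := b0 + (grad h b - grad h b0) *m M.
have F0 : F b0 = b0 by rewrite /F subrr mul0mx addr0.
have gradH (v : 'rV[R]_d) i : dot (grad (partial i h) b0) v = (v *m H) 0 i.
  by rewrite [RHS]mxE; apply: eq_bigr => j _; rewrite !mxE mulrC.
have Fid : tangent_to_id F b0.
  move=> e e0; have eC : 0 < e / C by rewrite divr_gt0.
  have near_r (i : 'I_d) : \forall r \near (0 : R)^'+, forall x y,
      `|x - b0| < r -> `|y - b0| < r ->
      `|partial i h x - partial i h y - ((x - y) *m H) 0 i| <= e / C * `|x - y|.
    have [r r_gt0 rP] :=
      class_C_strict_diff oU Ub (class_C_partial i hC) eC.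
    near=> t => x y xt yt; rewrite -gradH.
    have tr : t <= r by near: t; exact: nbhs_right_le.
    by apply: rP; apply: lt_le_trans tr.
  have [r [r_gt0 rP]] : exists r : R, 0 < r /\ forall i x y,
      `|x - b0| < r -> `|y - b0| < r ->
      `|partial i h x - partial i h y - ((x - y) *m H) 0 i| <= e / C * `|x - y|.
    apply: (@filter_ex _ ((0 : R)^'+)); apply: filterI.
      exact: nbhs_right_gt.
    exact: filter_forall near_r.
  exists r => // x y xr yr.
  have -> : F x - F y - (x - y) =
      (grad h x - grad h y - (x - y) *m H) *m M.
    rewrite [RHS]mulmxBl mulmxK // /F opprD addrACA subrr add0r -mulmxBl.
    by rewrite opprB addrA subrK.
  apply: le_trans (MC _) _; rewrite mulrC -ler_pdivlMr // mulrAC.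
  apply: norm_le_coord => [|i]; first by rewrite mulr_ge0 // ltW.
  have := rP i x y xr yr; apply: le_trans.
  by rewrite le_eqVlt; apply/orP; left; apply/eqP; congr (`|_|);
    rewrite [LHS]mxE [in LHS]mxE; congr (_ + _); rewrite !mxE.
have [rho [r [G [rho0 r_gt0 Gu Fxy]]]] := local_inverse F0 Fid r00.
have rho_gt0 : 0 < rho by case/andP: rho0.
have inj b b' : `|b - b0| < rho -> `|b' - b0| < rho -> F b = F b' -> b = b'.
  move=> br br' E; apply/eqP; rewrite -subr_eq0 -normr_le0.
  by apply: le_trans (Fxy _ _ br br') _; rewrite E subrr normr0 mulr0.
pose B x := G (b0 + (x - grad h b0) *m M).
have uC x : `|x - grad h b0| < r / C -> `|b0 + (x - grad h b0) *m M - b0| < r.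
  move=> xr; rewrite addrC addKr; apply: le_lt_trans (MC _) _.
  by rewrite mulrC -ltr_pdivlMr.
have BP x : `|x - grad h b0| < r / C -> `|B x - b0| < rho /\ F (B x) =
    b0 + (x - grad h b0) *m M.
  by move=> /uC /Gu.
exists rho, (r / C), B; split; first exact: rho0.
- by rewrite divr_gt0.
- have g00 : `|grad h b0 - grad h b0| < r / C by rewrite subrr normr0 divr_gt0.
  have b00 : `|b0 - b0| < rho by rewrite subrr normr0.
  have [B0 FB] := BP _ g00; apply: (inj _ _ B0 b00).
  by rewrite FB subrr mul0mx addr0 F0.
- move=> x xr; have [Bx FB] := BP x xr; split=> //.
    move: FB => /addrI /(congr1 (mulmx^~ H)); rewrite !mulmxKV // => /eqP.
    by rewrite subr_eq subrK => /eqP.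
  apply/continuous_normP => e e0.
  have [e1 [e10 e1r e1e]] : exists e1 : R, [/\ 0 < e1,
      e1 <= r / C - `|x - grad h b0| & 2 * (C * e1) <= e].
    exists (Num.min (r / C - `|x - grad h b0|) (e / (2 * C))); split.
    + by rewrite lt_min subr_gt0 xr divr_gt0 // mulr_gt0.
    + by rewrite ge_min lexx.
    + by rewrite mulrA mulrC -ler_pdivlMr ?mulr_gt0 // ge_min lexx orbT.
  apply/near_normP; exists e1 => // z zx.
  have zr : `|z - grad h b0| < r / C.
    rewrite -[z](subrK x) -addrA; apply: le_lt_trans (ler_normD _ _) _.
    by rewrite -ltrBrDr; apply: lt_le_trans zx _.
  have [Bz FBz] := BP z zr.
  apply: le_lt_trans (Fxy _ _ Bz Bx) _; rewrite FB FBz opprD addrACA subrr.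
  rewrite add0r -mulmxBl opprB addrA subrK.
  apply: le_lt_trans (ler_wpM2l _ (MC _)) _; first exact: ler0n.
  apply: lt_le_trans e1e; rewrite ltr_pM2l // ltr_pM2l //.
- by move=> b b' br br' E; apply: inj => //; rewrite /F E.
Unshelve. all: by end_near. Qed.

(** The partial derivatives of g are quotients of partial derivatives of phi
    along the graph of g, so each order of smoothness of g yields the next
    one. *)
Lemma implicit_class_C (R : realType) d (phi : 'rV[R]_d.+1 -> R)
    (W : set 'rV[R]_d.+1) (V : set 'rV[R]_d) (g : 'rV[R]_d -> R) k :
  open W -> (forall m, class_C m W phi) -> open V ->
  (forall x, V x -> {for x, continuous g}) ->
  (forall x, V x -> [/\ W (append_coord x (g x)), phi (append_coord x (g x)) = 0 &
      partial ord_max phi (append_coord x (g x)) != 0]) ->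
  class_C k V g.
Proof.
move=> oW phiC oV gc gP; elim: k => [|k IH]; first by split.
pose c x := append_coord x (g x).
have cl x l : c x 0 (lift ord_max l) = x 0 l by rewrite /c mxE liftK.
have cn x : c x 0 ord_max = g x by exact: append_coord_last.
have coordB (u v : 'rV[R]_d.+1) i : (u - v) 0 i = u 0 i - v 0 i.
  by rewrite !mxE.
have cC i : class_C k V (fun x => c x 0 i).
  have [j ->|->] := unliftP ord_max i.
    by apply: class_C_ext (class_C_coord oV k j) => // x _; rewrite cl.
  by apply: class_C_ext IH => // x _; exact: esym (cn x).
pose df j x := - (partial (lift ord_max j) phi (c x) *
  (partial ord_max phi (c x))^-1).
apply: (@class_C_intro _ _ _ oV _ _ df) => // [x j Vx|j]; last first.
  have compC i : class_C k V (fun x => partial i phi (c x)).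
    apply: class_C_comp oV oW _ cC (class_C_partial i (phiC k.+1)).
    by move=> x /gP[].
  apply: class_CN => //; apply: class_CM => //; apply: class_CV => //.
  by move=> x /gP[].
have [Wx phix pn0] := gP x Vx; rewrite -/(c x) in Wx phix pn0.
set pj := partial (lift ord_max j) phi (c x).
set pn := partial ord_max phi (c x) in pn0.
apply/is_derive_approxP => e e0.
have pn_gt0 : 0 < `|pn| by rewrite normr_gt0.
pose q := pj / pn; have q1 : 0 < 1 + `|q| by rewrite ltr_pwDl.
(* eps <= |pn| / 2 allows to absorb the increment of g on the right into the
   left hand side; the other bound makes the remaining error at most e |s|. *)
pose eps := Num.min (`|pn| / 2) (e * `|pn| / 2 / (1 + `|q|)).
have eps0 : 0 < eps by rewrite lt_min !divr_gt0 // mulr_gt0.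
have eps1 : eps <= `|pn| / 2 by rewrite ge_min lexx.
have eps2 : eps * (1 + `|q|) <= e * `|pn| / 2.
  by rewrite -ler_pdivlMr // ge_min lexx orbT.
have [r r0 rP] := class_C_strict_diff oW Wx (phiC 1%N) eps0.
have line_near (P : set 'rV[R]_d) : (\forall z \near x, P z) ->
    \forall s \near (0 : R), P (x + s *: delta_mx 0 j).
  move=> /near_normP[r1 r10 r1P]; apply/(@near_normP R R^o); exists r1 => // s.
  rewrite subr0 => sr; apply: r1P; rewrite addrC addKr normrZ.
  apply: le_lt_trans sr; rewrite ler_piMr //; apply: norm_le_coord => // i.
  by rewrite mxE; case: (_ && _); rewrite ?normr1 ?normr0.
have good : \forall z \near x, V z /\ `|c z - c x| < r.
  have Vn : nbhs x V by exact: open_nbhs_nbhs.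
  have xr : \forall z \near x, `|z - x| < r by apply/near_normP; exists r.
  have gr := (continuous_normP _ _).1 (gc x Vx) r r0.
  apply: filterS3 Vn xr gr => z Vz zx gz; split=> //.
  apply: norm_lt_coord => // i; have [l ->|->] := unliftP ord_max i.
    rewrite coordB !cl; apply: le_lt_trans zx.
    by have := coord_le_norm (z - x) l; rewrite !mxE.
  by rewrite coordB !cn.
apply: filterS (line_near _ good) => s [].
set z := x + _ => Vz zr; pose t := g z - g x.
have dotE : dot (grad phi (c x)) (c z - c x) = s * pj + t * pn.
  have -> : c z - c x = s *: delta_mx 0 (lift ord_max j) +
      t *: delta_mx 0 ord_max.
    apply/rowP => i; have [l ->|->] := unliftP ord_max i.
      rewrite coordB !cl !mxE !eqxx /= (inj_eq lift_inj).
      rewrite (eq_sym (lift _ _)) (negPf (neq_lift _ _)) mulr0 addr0.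
      by rewrite [LHS]addrC addKr.
    rewrite coordB !cn !mxE !eqxx /= (negPf (neq_lift _ _)).
    by rewrite mulr0 add0r mulr1.
  by rewrite dotDr !dotZr !dot_delta !mxE.
have [_ phiz _] := gP z Vz.
have := rP (c z) (c x) zr; rewrite subrr normr0 => /(_ r0).
rewrite phiz phix subr0 sub0r normrN dotE.
have ctn : `|c z - c x| <= `|s| + `|t|.
  apply: norm_le_coord => [|i]; first by rewrite addr_ge0.
  have [l ->|->] := unliftP ord_max i.
    rewrite coordB !cl !mxE [_ - x 0 l]addrC addKr normrM.
    apply: ler_wpDr => //; rewrite ler_piMr //.
    by case: (_ && _); rewrite ?normr1 ?normr0.
  by rewrite coordB !cn ler_wpDl.
move=> /le_trans/(_ (ler_wpM2l (ltW eps0) ctn)) H.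
rewrite /df -/pj -/pn -/q mulrN opprK -/t.
have Hq : `|pn| * `|t + s * q| <= eps * (`|s| + `|t|).
  rewrite -normrM; apply: le_trans H.
  by rewrite (_ : pn * (t + s * q) = s * pj + t * pn) // /q; field.
have tq : `|t| <= `|t + s * q| + `|s| * `|q|.
  rewrite -{1}[t](addrK (s * q)) -normrM.
  by apply: le_trans (ler_normB _ _) _.
have H1 : `|pn| * `|t + s * q| <=
    eps * (1 + `|q|) * `|s| + eps * `|t + s * q|.
  apply: le_trans Hq _; rewrite -mulrA -mulrDr ler_wpM2l ?(ltW eps0) //.
  by rewrite mulrDl mul1r [`|q| * _]mulrC -addrA lerD2l addrC.
have H2 : eps * `|t + s * q| <= `|pn| / 2 * `|t + s * q| by rewrite ler_wpM2r.
have H3 : eps * (1 + `|q|) * `|s| <= e * `|pn| / 2 * `|s| by rewrite ler_wpM2r.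
rewrite -(ler_pM2l pn_gt0).
have : `|pn| * `|t + s * q| <= e * `|pn| / 2 * `|s| + `|pn| / 2 * `|t + s * q|.
  by apply: le_trans H1 _; apply: lerD.
have -> : `|pn| / 2 * `|t + s * q| = `|pn| * `|t + s * q| / 2 by field.
have -> : `|pn| * (e * `|s|) = 2 * (e * `|pn| / 2 * `|s|) by field.
lra.
Qed.

(** * The local equation of the singular hypersurface *)

(** Moving the covector inside the normal space of the stratum fixes the
    contact point to first order, while contact points move with the slope
    like grad h does.  Hence the normal space is a line. *)
Lemma contact_normals (R : realType) (d s : nat)
    (Gam : 'I_s -> set 'rV[R]_d.+1) (x0 : 'rV[R]_d.+1) (J : {set 'I_s})
    (phi : 'I_s -> 'rV[R]_d.+1 -> R) (U : set 'rV[R]_d) (h : 'rV[R]_d -> R)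
    (b0 : 'rV[R]_d) (a : 'I_s -> R) :
  local_frame Gam x0 J phi -> open U -> U b0 -> class_C 2 U h ->
  (\forall bq \near (b0, h b0), Qset_affine Gam bq <-> bq.2 = h bq.1) ->
  height x0 b0 = h b0 ->
  conormal b0 = \sum_(j in J) a j *: grad (phi j) x0 ->
  (\forall b \near b0, forall x, contact Gam x b -> height x b = h b ->
    col' ord_max x = grad h b) ->
  \det (hessian h b0) != 0 ->
  forall k, k \in J ->
    grad (phi k) x0 = grad (phi k) x0 0 ord_max *: conormal b0.
Proof.
move=> frame oU Ub hC hQ height0 a_span cp hdet k kJ.
pose c (i : 'I_s) : R := (i == k)%:R.
have T0 j : j \in J -> dot (grad (phi j) x0) 0 = 0 by rewrite dot0r.
have [x [b [xx0 bb0 dx db ct]]] := contact_curve frame hQ height0 a_span c T0.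
have covE : covelocity x0 J phi a 0 c = grad (phi k) x0.
  rewrite /covelocity (bigD1 k) //= /c eqxx scale1r hess_apply0 scaler0 addr0.
  rewrite big1 ?addr0 // => i /andP[_ /negPf ->].
  by rewrite hess_apply0 scaler0 scale0r addr0.
set w := slope_velocity x0 J phi b0 a 0 c in db.
have w0 : w = 0.
  have gw i : dot (grad (partial i h) b0) w = 0.
    have dg : is_derive (0 : R) 1 (fun t => partial i h (b t))
        (dot (grad (partial i h) b0) w).
      apply: (@strict_diff_comp _ R^o) => //; rewrite bb0.
      exact: class_C_strict_diff oU Ub (class_C_partial i hC).
    have := is_derive_unique_near0 (is_derive_subf (dx (lift ord_max i)) dg) _.
    rewrite mxE sub0r => H; apply/eqP; rewrite -oppr_eq0; apply/eqP; apply: H.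
    apply: filterS2 ct (curve_near bb0 db cp) => t [ctt ht] /(_ _ ctt ht).
    move=> /rowP/(_ i); rewrite mxE => ->; apply/eqP; rewrite subr_eq0.
    by apply/eqP; rewrite mxE.
  have Hu : (hessian h b0)^T \in unitmx by rewrite unitmxE det_tr unitfE.
  rewrite -[w](mulmxK Hu) (_ : w *m _ = 0) ?mul0mx //.
  apply/rowP => i; rewrite [RHS]mxE -[RHS](gw i) mxE.
  by apply: eq_bigr => j _; rewrite !mxE mulrC.
move: w0; rewrite /w /slope_velocity covE => /eqP; rewrite oppr_eq0 addr_eq0.
move=> /eqP nuE; apply: row_appendP; last first.
  by rewrite [RHS]mxE conormal_last mulr1.
rewrite nuE; apply/rowP => i.
by rewrite !mxE liftK /= !mxE mulrN.
Qed.

Theorem theorem2 (R : realType) (d : nat) (hd : (2 <= d.+1)%N)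
    (f : 'rV[R]_d.+1 -> R) (s : nat) (Gam : 'I_s -> set 'rV[R]_d.+1)
    (hf : jump_setting f Gam)
    (bbar : 'rV[R]_d) (qbar : R) (hQ : Qset_affine Gam (bbar, qbar))
    (U : set 'rV[R]_d) (hU : open_nbhs bbar U) (h : 'rV[R]_d -> R)
    (hqbar : qbar = h bbar)
    (hQh : \forall bq \near (bbar, qbar),
       Qset_affine Gam bq <-> bq.2 = h bq.1)
    (hdet : forall b, U b -> \det (hessian h b) != 0)
    (l : nat) (hl : (2 <= l)%N) (hC : class_C l U h)
    (xbar : 'rV[R]_d) (hxbar : xbar = grad h bbar) :
  exists (V : set 'rV[R]_d) (g : 'rV[R]_d -> R),
    [/\ open_nbhs xbar V,
        is_legendre U h bbar V g,
        local_equation (boundary (supp f)) V g &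
        class_C l V g].
Proof.
subst xbar qbar; have [oU Ub] := hU; have hC2 := class_C_le hl hC.
have [supp_compact bdE hyp edges pos _ _ _] := hf.
have Gam_supp i : Gam i `<=` supp f.
  move=> x ix; have : boundary (supp f) x by rewrite bdE; exists i.
  by case=> /closed_closure.
have frames := local_frame_exists hyp edges pos.
have cp := contact_point supp_compact Gam_supp frames oU Ub hC2 hQh.
(* The only possible point of contact for the slope b. *)
pose P b := append_coord (grad h b) (dot b (grad h b) - h b).
have P_unique b x : col' ord_max x = grad h b -> height x b = h b -> x = P b.
  move=> xb hx; apply: row_appendP; first by rewrite col'_append_coord.
  by rewrite append_coord_last -hx /height xb opprB addrC subrK.
have P_contact : \forall b \near bbar, U b /\ contact Gam (P b) b.
  have hc : {for bbar, continuous h} by exact: class_C_continuous hC2 Ub.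
  have Un : nbhs bbar U by exact: open_nbhs_nbhs.
  have near_Q : \forall b \near bbar, Qset_affine Gam (b, h b).
    have [[A B] [/= Ab Bh] AB] := hQh.
    by apply: filterS2 Ab (hc _ Bh) => b Abb Bhb; apply/(AB (b, h b)).
  apply: filterS3 Un near_Q cp => b Ubb /Qset_affineP[x xb hx] cpb.
  by split=> //; rewrite -(P_unique b x) // cpb.
have [_ contact0] := nbhs_singleton P_contact.
have height_P b : height (P b) b = h b.
  by rewrite /height col'_append_coord append_coord_last subKr.
have [J [phi frame]] := frames (P bbar).
have [a a_span] := nbhs_singleton (contact_span frame) bbar contact0.
have normals k (kJ : k \in J) := contact_normals frame oU Ub hC2 hQh
  (height_P bbar) a_span cp (hdet _ Ub) kJ.
have normal_neq0 k : k \in J -> grad (phi k) (P bbar) 0 ord_max != 0.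
  move=> kJ; apply/eqP => n0.
  have comb0 : \sum_(i in J) (i == k)%:R *: grad (phi i) (P bbar) = 0.
    rewrite (bigD1 k) //= (normals k kJ) n0 scale0r scaler0 add0r.
    by rewrite big1 // => i /andP[_ /negPf ->]; rewrite scale0r.
  have /eqP := frame_free frame comb0 kJ.
  by rewrite eqxx oner_eq0.
have [j jJ] : exists j, j \in J.
  have [J0|[j jJ]] := finset.set_0Vmem J; last by exists j.
  have := conormal_last bbar; rewrite a_span J0 finset.big_set0 mxE => /eqP.
  by rewrite eq_sym oner_eq0.
(* All the normals are proportional, so there is only one of them. *)
have J1 k : k \in J -> k = j.
  move=> kJ; have [//|kj] := eqVneq k j.
  pose nuk := grad (phi k) (P bbar) 0 ord_max.
  pose nuj := grad (phi j) (P bbar) 0 ord_max.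
  have comb0 : \sum_(i in J) (if i == k then nuj else
      if i == j then - nuk else 0) *: grad (phi i) (P bbar) = 0.
    rewrite (bigD1 k) //= eqxx (bigD1 j) /=; last by rewrite jJ eq_sym.
    rewrite eqxx [j == k]eq_sym (negPf kj).
    rewrite big1 => [|i /andP[/andP[_ /negPf ->] /negPf ->]].
      rewrite addr0 (normals k kJ) (normals j jJ) !scalerA -scalerDl.
      by rewrite -/nuk -/nuj mulNr mulrC subrr scale0r.
    by rewrite scale0r.
  have /eqP := frame_free frame comb0 kJ.
  by rewrite eqxx (negPf (normal_neq0 j jJ)).
(* Only the piece j passes through P bbar, and it is not vertical there. *)
have [W [oW Wx] phiC] := frame_smooth frame jJ.
set pn := grad (phi j) (P bbar) 0 ord_max.
have pn0 : pn != 0 := normal_neq0 j jJ.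
have Wn : nbhs (P bbar) W by exact: open_nbhs_nbhs.
have pn_near : \forall x \near P bbar, partial ord_max (phi j) x != 0.
  have pc : {for P bbar, continuous (partial ord_max (phi j))}.
    exact: smooth_near_partial_continuous (frame_smooth frame jJ).
  have nz : nbhs (partial ord_max (phi j) (P bbar)) [set r | r != 0].
    apply: open_nbhs_nbhs; split; first exact: open_neq.
    by rewrite /= -[X in X _ != 0]grad_coordE.
  exact: pc nz.
have Gam_near : \forall x \near P bbar,
    boundary (supp f) x -> phi j x = 0.
  apply: filterS (frame_sub frame) => x xsub; rewrite bdE => -[i _ ix].
  by have [/J1 -> ] := xsub i ix.
have [r1 r10 r1P] : exists2 r1 : R, 0 < r1 & forall x, `|x - P bbar| < r1 ->
    [/\ W x, partial ord_max (phi j) x != 0 &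
        boundary (supp f) x -> phi j x = 0].
  apply/near_normP; apply: filterS3 Wn pn_near Gam_near => x *.
  by split.
have pn2 : 0 < `|pn| / 2 by rewrite divr_gt0 ?normr_gt0.
have [r2 r20 mono] := smooth_near_strict_diff (frame_smooth frame jJ) pn2.
(* phi j is strictly monotone in the last coordinate near P bbar. *)
have last_inj x y : `|x - P bbar| < r2 -> `|y - P bbar| < r2 ->
    col' ord_max x = col' ord_max y -> phi j x = phi j y -> x = y.
  move=> xr yr xy' xyphi; apply: row_appendP => //; apply/eqP.
  rewrite -subr_eq0 -normr_le0 leNgt; apply/negP => t0.
  have E : x - y = (x 0 ord_max - y 0 ord_max) *: delta_mx 0 ord_max.
    apply: row_appendP; last by rewrite !mxE !eqxx mulr1.
    apply/rowP => i; have /rowP/(_ i) := xy'; rewrite !mxE => ->.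
    by rewrite subrr (eq_sym (lift _ _)) (negPf (neq_lift _ _)) mulr0.
  have := mono x y xr yr; rewrite xyphi subrr sub0r normrN E dotZr dot_delta.
  rewrite -/pn normrM normrZ.
  have delta1 : `|delta_mx 0 ord_max : 'rV[R]_d.+1| <= 1.
    apply: norm_le_coord => // i; rewrite mxE.
    by case: (_ && _); rewrite ?normr1 ?normr0.
  apply/negP; rewrite -ltNge.
  apply: le_lt_trans (_ : `|pn| / 2 * `|x 0 ord_max - y 0 ord_max| < _).
    by rewrite ler_wpM2l ?(ltW pn2) // ler_piMr.
  rewrite mulrC ltr_pM2l // ltr_pdivrMr // ltr_pMr ?normr_gt0 //.
  by rewrite ltr1n.
have /near_normP[r3 r30 r3P] := P_contact.
have [rho [r [B [/andP[rho0 rho3] r0 B0 BP Binj]]]] :=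
  gradient_local_inverse oU Ub hC2 (hdet _ Ub) r30.
(* The Legendre transform; B is the inverse of grad h. *)
pose g x := dot (B x) x - h (B x).
have gradB x : `|x - grad h bbar| < r -> P (B x) = append_coord x (g x).
  by move=> /BP[_ gB _]; rewrite /P gB.
have UB x : `|x - grad h bbar| < r -> U (B x).
  by move=> /BP[Bx _ _]; have [] := r3P _ (lt_le_trans Bx rho3).
have gc x : `|x - grad h bbar| < r -> {for x, continuous g}.
  move=> xr; have [Bx _ Bc] := BP x xr; apply: continuousB.
    apply: dot_continuous => i; last exact: coord_continuous.
    apply: (@continuous_comp _ _ _ B (fun v : 'rV[R]_d => v 0 i)) => //.
    exact: coord_continuous.
  apply: (@continuous_comp _ _ _ B h) => //.
  exact: class_C_continuous hC2 (UB x xr).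
have boundary_graph x : `|x - grad h bbar| < r ->
    boundary (supp f) (append_coord x (g x)).
  move=> xr; have [Bx _ _] := BP x xr.
  have [_ [I [I0 xI _]]] := r3P _ (lt_le_trans Bx rho3).
  rewrite -gradB // bdE; have /finset.set0Pn[i iI] := I0.
  by exists i => //; exact: xI.
have xr0 : `|grad h bbar - grad h bbar| < r by rewrite subrr normr0.
have P0 : P bbar = append_coord (grad h bbar) (g (grad h bbar)).
  by rewrite -gradB // B0.
pose m := Num.min r1 r2.
have m0 : 0 < m by rewrite lt_min r10.
have append_near x t : `|x - grad h bbar| < m -> `|t - g (grad h bbar)| < m ->
    `|append_coord x t - P bbar| < m.
  move=> xm tm; rewrite P0; apply: norm_lt_coord => // i.
  have [k ->|->] := unliftP ord_max i.
    rewrite mxE [(- _ : 'rV_ _) _ _]mxE !mxE !liftK /=.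
    by apply: le_lt_trans xm; have := coord_le_norm (x - grad h bbar) k; rewrite !mxE.
  by rewrite mxE [(- _ : 'rV_ _) _ _]mxE !append_coord_last.
have [e e0 eP] : exists2 e : R, 0 < e & forall x, `|x - grad h bbar| < e ->
    [/\ `|x - grad h bbar| < r, `|x - grad h bbar| < m &
        `|g x - g (grad h bbar)| < m].
  apply/near_normP.
  have nr : \forall x \near grad h bbar, `|x - grad h bbar| < r.
    by apply/near_normP; exists r.
  have nm : \forall x \near grad h bbar, `|x - grad h bbar| < m.
    by apply/near_normP; exists m.
  have ng := (continuous_normP _ _).1 (gc _ xr0) m m0.
  by apply: filterS3 nr nm ng => x *; split.
pose V := ball (grad h bbar) e.
have VP x : V x -> [/\ `|x - grad h bbar| < r, `|x - grad h bbar| < m &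
    `|g x - g (grad h bbar)| < m].
  by rewrite /V -ball_normE /= distrC => /eP.
have oV : open V by exact: ball_open.
have m1 : m <= r1 by rewrite ge_min lexx.
have m2 : m <= r2 by rewrite ge_min lexx orbT.
have graph_near x : V x -> `|append_coord x (g x) - P bbar| < m.
  by move=> /VP[_ xm gm]; exact: append_near.
have graph_phi x : V x -> [/\ W (append_coord x (g x)),
    phi j (append_coord x (g x)) = 0 &
    partial ord_max (phi j) (append_coord x (g x)) != 0].
  move=> Vx; have [Wxg pnxg bz] := r1P _ (lt_le_trans (graph_near x Vx) m1).
  by have [xr _ _] := VP x Vx; split=> //; exact/bz/boundary_graph.
exists V, g; split.
- by split=> //; exact: ballxx.
- exists [set b | `|b - bbar| < rho]; split.
  + by apply: (near_normP bbar _).2; exists rho.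
  + by move=> b /= brho; have [] := r3P _ (lt_le_trans brho rho3).
  move=> x /VP[xr _ _]; have [Bx gB _] := BP x xr; exists (B x); split=> //.
  by move=> b brho E; apply: Binj => //; rewrite gB.
- exists [set t | `|t - g (grad h bbar)| < m]; split.
  + have -> : [set t | `|t - g (grad h bbar)| < m] = ball (g (grad h bbar)) m.
      by apply/seteqP; split=> t; rewrite -ball_normE /= distrC.
    exact: ball_open.
  + by move=> x /VP[].
  move=> x Vx /= xm; set x' := col' ord_max x in Vx *.
  have [xr x'm gm] := VP _ Vx.
  have xE : x = append_coord x' (x 0 ord_max).
    by apply: row_appendP; rewrite ?col'_append_coord ?append_coord_last.
  split=> [xb|xg]; last by rewrite xE xg; exact: boundary_graph.
  have xnear : `|x - P bbar| < m by rewrite xE; exact: append_near.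
  have [_ _ /(_ xb) phix] := r1P _ (lt_le_trans xnear m1).
  have [_ phig _] := graph_phi _ Vx.
  rewrite (last_inj x (append_coord x' (g x'))) ?append_coord_last //.
  + exact: lt_le_trans m2.
  + exact: lt_le_trans (graph_near _ Vx) m2.
  + by rewrite col'_append_coord.
  + by rewrite phix phig.
- by apply: implicit_class_C oW phiC oV _ graph_phi => x /VP[xr _ _]; exact: gc.
Qed.
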